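(* Let $n \ge 1$ and let $T \in \mathcal{B}(H^2(\mathbb{D}^n))$ be a nonzero operator satisfying the gcd property. Then $T$ is a product of two model projections if and only if $$T = P_{\mathcal{Q}_{\psi_T}}\, P_{\mathcal{Q}_{\psi_{T^*}}}.$$
   Context: $H^2(\mathbb{D}^n)$ is the Hardy space of square summable analytic functions on the polydisc $\mathbb{D}^n$, and $H^\infty(\mathbb{D}^n)$ is the algebra of bounded analytic functions on $\mathbb{D}^n$. A function $\varphi \in H^\infty(\mathbb{D}^n)$ is inner if its radial limits satisfy $|\varphi| = 1$ a.e. on $\mathbb{T}^n$. $P_{\mathcal{S}}$ is the orthogonal projection onto a closed subspace $\mathcal{S}$. For an inner function $\varphi \in H^\infty(\mathbb{D}^n)$ the model space is $\mathcal{Q}_\varphi = H^2(\mathbb{D}^n) \ominus \varphi H^2(\mathbb{D}^n)$, and $P_{\mathcal{Q}_\varphi}$ is called a model projection. For inner functions, $\varphi$ divides $\psi$ if $\psi = \varphi\theta$ for some $\theta \in H^\infty(\mathbb{D}^n)$. An inner function $\varphi \in H^\infty(\mathbb{D}^n)$ is a greatest common divisor (gcd) of a nonempty set $\{\varphi_\alpha\}_{\alpha\in\Lambda}$ of inner functions in $H^\infty(\mathbb{D}^n)$ if (1) $\varphi$ divides $\varphi_\alpha$ for all $\alpha$, and (2) whenever an inner function $\psi \in H^\infty(\mathbb{D}^n)$ divides $\varphi_\alpha$ for all $\alpha$, then $\psi$ divides $\varphi$. It is unique up to a unimodular constant when it exists. For nonzero $T \in \mathcal{B}(H^2(\mathbb{D}^n))$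 let $\mathcal{J}_T = \{\varphi \in H^\infty(\mathbb{D}^n): \varphi \text{ is inner and } \varphi H^2(\mathbb{D}^n) \subseteq \ker T^*\}$, and similarly $\mathcal{J}_{T^*}$ with $\ker T$ in place of $\ker T^*$. $T$ satisfies the gcd property if both $\mathcal{J}_T$ and $\mathcal{J}_{T^*}$ contain a gcd (that is, $\mathcal{J}_T$ has an element that is a gcd of $\mathcal{J}_T$, and likewise for $\mathcal{J}_{T^*}$). Then $\psi_T := \gcd \mathcal{J}_T$ and $\psi_{T^*} := \gcd \mathcal{J}_{T^*}$. *)

(* Defs.v *)
From HB Require Import structures.
From mathcomp Require Import all_boot all_order all_algebra finmap.
From mathcomp Require Import complex ring.
From mathcomp Require Import all_classical all_reals all_analysis.
From mathcomp.analysis.showcase Require summability.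

Set Implicit Arguments.
Unset Strict Implicit.
Unset Printing Implicit Defensive.
Import Order.TTheory GRing.Theory Num.Theory.
Import numFieldNormedType.Exports.
Local Open Scope classical_set_scope.
Local Open Scope complex_scope.
Local Open Scope ring_scope.

#[global] Existing Instance summability.totally_filter.

Notation multi_index n := {ffun 'I_n -> nat}.

Record polydisc (R : realType) (n : nat) := Polydisc {
  polydisc_val :> 'rV[R[i]]_n ;
  _ : [forall i, `|polydisc_val ord0 i| < 1] }.

HB.instance Definition _ (R : realType) (n : nat) :=
  [isSub for @polydisc_val R n].
HB.instance Definition _ (R : realType) (n : nat) :=
  [Choice of polydisc R n by <:].

Lemma polydisc0_subproof (R : realType) (n : nat) :
  [forall i, `|(0 : 'rV[R[i]]_n) ord0 i| < 1].
Proof. by apply/forallP => i; rewrite mxE normr0 ltr01. Qed.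

Definition polydisc0 (R : realType) (n : nat) : polydisc R n :=
  Polydisc (polydisc0_subproof R n).

(* The scalars are R[i]^o: the regular module carries both the topology and the
   left-module structure over R[i]. *)
Notation cfun R n := (polydisc R n -> R[i]^o).

(* Unconditional (equivalently, absolute) convergence of a family indexed by
   multi-indices: the net of partial sums over finite sets converges. *)
Definition has_sum (R : realType) (n : nat)
    (u : multi_index n -> R[i]^o) (s : R[i]^o) : Prop :=
  summability.partial_sum u @ summability.totally --> s.

Definition power_term (R : realType) (n : nat) (a : multi_index n -> R[i]^o)
    (c z : 'rV[R[i]]_n) (k : multi_index n) : R[i]^o :=
  a k * \prod_(i < n) (z ord0 i - c ord0 i) ^+ k i.

Definition analytic (R : realType) (n : nat) (f : cfun R n) : Prop :=
  forall c : polydisc R n, exists (a : multi_index n -> R[i]^o) (r : R),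
    0 < r /\
    forall z : polydisc R n, (forall i, `|z ord0 i - c ord0 i| < r%:C) ->
      has_sum (power_term a c z) (f z).

Definition square_summable (R : realType) (n : nat)
    (a : multi_index n -> R[i]^o) : Prop :=
  (\esum_(k in [set: multi_index n]) (Normc.normc (a k) ^+ 2)%:E < +oo)%E.

Definition expands (R : realType) (n : nat) (f : cfun R n)
    (a : multi_index n -> R[i]^o) : Prop :=
  forall z : polydisc R n, has_sum (power_term a 0 z) (f z).

Definition hardy2 (R : realType) (n : nat) (f : cfun R n) : Prop :=
  exists2 a, expands f a & square_summable a.

Definition hardy2_pred (R : realType) (n : nat) : {pred cfun R n} :=
  [pred f | `[< hardy2 f >]].

Lemma has_sum0 (R : realType) (n : nat) :
  has_sum (fun=> 0 : R[i]^o) (0 : R[i]^o) (n := n).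
Proof.
rewrite /has_sum; under eq_cvg do rewrite /summability.partial_sum big1//.
exact: cvg_cst.
Qed.

Lemma has_sumZD (R : realType) (n : nat) (x : R[i])
    (u v : multi_index n -> R[i]^o) (s t : R[i]^o) :
  has_sum u s -> has_sum v t ->
  has_sum (fun k => x *: u k + v k) (x *: s + t).
Proof.
move=> us vt; rewrite /has_sum.
rewrite (_ : summability.partial_sum _ =
  (fun A => x *: summability.partial_sum u A + summability.partial_sum v A)).
  by apply: cvgD => //; apply: cvgZr.
by apply/funext => A; rewrite /summability.partial_sum big_split/= scaler_sumr.
Qed.

Lemma normc_sqrZD (R : realType) (x a b : R[i]) :
  Normc.normc (x * a + b) ^+ 2 <=
  2 * Normc.normc x ^+ 2 * Normc.normc a ^+ 2 + 2 * Normc.normc b ^+ 2.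
Proof.
rewrite -mulrA -mulrDr -exprMn -Normc.normcM.
move: (x * a) => {x a} [p q]; case: b => r s.
rewrite /Normc.normc /= !sqr_sqrtr ?addr_ge0 ?sqr_ge0//.
rewrite -subr_ge0 (_ : _ - _ = (p - r) ^+ 2 + (q - s) ^+ 2); last by ring.
by rewrite addr_ge0 ?sqr_ge0.
Qed.

Lemma esumZ_lty (R : realType) (I : choiceType) (c : R) (f : I -> \bar R) :
  0 <= c -> (forall i, 0 <= f i)%E -> (\esum_(i in [set: I]) f i < +oo)%E ->
  (\esum_(i in [set: I]) (c%:E * f i) < +oo)%E.
Proof.
move=> c0 f0 fy.
apply: (@le_lt_trans _ _ (c%:E * \esum_(i in [set: I]) f i)%E); last first.
  by rewrite lte_mul_pinfty.
apply: ge_ereal_sup => _ [X XI <-].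
rewrite -ge0_mule_fsumr// lee_wpmul2l ?lee_fin//.
by apply: ereal_sup_ubound; exists X.
Qed.

Lemma hardy2_submod_closed (R : realType) (n : nat) :
  submod_closed (@hardy2_pred R n).
Proof.
split.
  apply/asboolP; exists (fun=> 0).
    move=> z; rewrite (_ : power_term _ _ _ = fun=> 0); first exact: has_sum0.
    by apply/funext => k; rewrite /power_term mul0r.
  rewrite /square_summable esum1 ?ltry// => k _.
  by rewrite Normc.normc0 expr0n.
move=> x f g /asboolP[a fa sa] /asboolP[b gb sb]; apply/asboolP.
exists (fun k => x *: a k + b k).
  move=> z.
  rewrite (_ : power_term _ _ _ =
    fun k => x *: power_term a 0 z k + power_term b 0 z k).
    exact: has_sumZD (fa z) (gb z).
  by apply/funext => k; rewrite /power_term mulrDl scalerAl.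
pose c := (2 * Normc.normc x ^+ 2)%R.
have c0 : 0 <= c by rewrite mulr_ge0 ?sqr_ge0.
rewrite /square_summable.
apply: (@le_lt_trans _ _ (\esum_(k in [set: multi_index n])
   (c%:E * (Normc.normc (a k) ^+ 2)%:E + 2%:E * (Normc.normc (b k) ^+ 2)%:E))%E).
  apply: le_esum => k _.
  by rewrite -!EFinM -EFinD lee_fin; exact: normc_sqrZD.
rewrite esumD; first last.
- by move=> k _; rewrite -EFinM lee_fin mulr_ge0 ?sqr_ge0.
- by move=> k _; rewrite -EFinM lee_fin mulr_ge0 ?sqr_ge0.
by rewrite lte_add_pinfty// esumZ_lty ?sqr_ge0// => k; rewrite lee_fin sqr_ge0.
Qed.

HB.instance Definition _ (R : realType) (n : nat) :=
  GRing.isSubmodClosed.Build _ _ (@hardy2_pred R n)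
    (@hardy2_submod_closed R n).

Record H2 (R : realType) (n : nat) := MkH2 {
  H2_val :> cfun R n ;
  _ : H2_val \in @hardy2_pred R n }.

HB.instance Definition _ (R : realType) (n : nat) := [isSub for @H2_val R n].
HB.instance Definition _ (R : realType) (n : nat) :=
  [Choice of H2 R n by <:].
HB.instance Definition _ (R : realType) (n : nat) :=
  [SubChoice_isSubLmodule of H2 R n by <:].

(* By uniqueness of power series coefficients, the only choice. *)
Definition taylor (R : realType) (n : nat) (f : H2 R n) :
    multi_index n -> R[i]^o :=
  xget (fun=> 0) [set a | expands f a].

Definition h2dot (R : realType) (n : nat) (f g : H2 R n) : R[i]^o :=
  summability.sum (fun k => taylor f k * (taylor g k)^*%C : R[i]^o).

Definition h2norm (R : realType) (n : nat) (f : H2 R n) : R :=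
  Num.sqrt (complex.Re (h2dot f f)).

Definition bounded_operator (R : realType) (n : nat) (T : H2 R n -> H2 R n) :
    Prop :=
  exists M : R, forall f, h2norm (T f) <= M * h2norm f.

Definition adjoint (R : realType) (n : nat) (T : H2 R n -> H2 R n) :
    H2 R n -> H2 R n :=
  xget (fun=> 0) [set S | forall f g, h2dot (T f) g = h2dot f (S g)].

Definition op_ker (R : realType) (n : nat) (T : H2 R n -> H2 R n) :
    set (H2 R n) :=
  [set f | T f = 0].

Definition orthocomp (R : realType) (n : nat) (S : set (H2 R n)) :
    set (H2 R n) :=
  [set f | forall g, S g -> h2dot f g = 0].

(* The point of S whose difference with f is orthogonal to S; it exists and is
   unique when S is a closed subspace. *)
Definition orthproj (R : realType) (n : nat) (S : set (H2 R n))
    (f : H2 R n) : H2 R n :=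
  xget 0 [set g | S g /\ orthocomp S (f - g)].

Definition Hinfty (R : realType) (n : nat) : set (cfun R n) :=
  [set phi | analytic phi /\
    exists M : R, forall z, `|phi z : R[i]| <= M%:C].

(* Lebesgue-null subsets of R^n: for every e > 0, covered by countably many
   boxes of total volume at most e. *)
Definition lebesgue_null (R : realType) (n : nat) (A : set 'rV[R]_n) : Prop :=
  forall e : R, 0 < e ->
  exists lo hi : nat -> 'rV[R]_n,
    [/\ forall j i, lo j ord0 i <= hi j ord0 i,
        A `<=` \bigcup_j [set t : 'rV[R]_n |
          forall i, lo j ord0 i <= t ord0 i <= hi j ord0 i] &
        (\sum_(0 <= j <oo) (\prod_(i < n) (hi j ord0 i - lo j ord0 i))%:E
           <= e%:E)%E].

(* The point (r e^(i t_1), .., r e^(i t_n)), with a junk value outside the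
   polydisc (that is, when n > 0, unless -1 < r < 1). *)
Definition radial_point (R : realType) (n : nat) (t : 'rV[R]_n) (r : R) :
    polydisc R n :=
  insubd (polydisc0 R n)
    (\row_i (r%:C * (cos (t ord0 i) +i* sin (t ord0 i)))).

Definition unimodular_radial_limit (R : realType) (n : nat) (phi : cfun R n)
    (t : 'rV[R]_n) : Prop :=
  exists2 l : R[i]^o,
    phi (radial_point t r) @[r --> (1 : R)^'-] --> l & `|l : R[i]| = 1.

(* The torus is parametrized by angles in [0, 2 pi[^n. *)
Definition inner (R : realType) (n : nat) : set (cfun R n) :=
  [set phi | Hinfty phi /\
    lebesgue_null
      [set t : 'rV[R]_n | (forall i, 0 <= t ord0 i < 2 * pi) /\
         ~ unimodular_radial_limit phi t]].

(* For inner phi and psi. *)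
Definition divides (R : realType) (n : nat) (phi psi : cfun R n) : Prop :=
  exists2 theta, Hinfty theta & forall z, psi z = phi z * theta z.

Definition is_gcd (R : realType) (n : nat) (J : set (cfun R n))
    (phi : cfun R n) : Prop :=
  [/\ J !=set0, inner phi,
      forall psi, J psi -> divides phi psi &
      forall psi, inner psi -> (forall chi, J chi -> divides psi chi) ->
        divides psi phi].

Definition mult_range (R : realType) (n : nat) (phi : cfun R n) :
    set (H2 R n) :=
  [set g | exists f : H2 R n, forall z, g z = phi z * f z].

Definition model_space (R : realType) (n : nat) (phi : cfun R n) :
    set (H2 R n) :=
  orthocomp (mult_range phi).

Definition model_projection (R : realType) (n : nat) (phi : cfun R n) :
    H2 R n -> H2 R n :=
  orthproj (model_space phi).

Definition inner_in_ker (R : realType) (n : nat) (T : H2 R n -> H2 R n) :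
    set (cfun R n) :=
  [set phi | inner phi /\ mult_range phi `<=` op_ker T].

(* inner_of T is the set J_T, and inner_of_adj T is J_(T^* ). *)
Definition inner_of (R : realType) (n : nat) (T : H2 R n -> H2 R n) :
    set (cfun R n) :=
  inner_in_ker (adjoint T).

Definition inner_of_adj (R : realType) (n : nat) (T : H2 R n -> H2 R n) :
    set (cfun R n) :=
  inner_in_ker T.

Definition contains_gcd (R : realType) (n : nat) (J : set (cfun R n)) : Prop :=
  exists2 phi, J phi & is_gcd J phi.

Definition gcd_property (R : realType) (n : nat) (T : H2 R n -> H2 R n) :
    Prop :=
  contains_gcd (inner_of T) /\ contains_gcd (inner_of_adj T).

Definition product_of_two_model_projections (R : realType) (n : nat)
    (T : H2 R n -> H2 R n) : Prop :=
  exists phi psi : cfun R n,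
    [/\ inner phi, inner psi &
        T = model_projection phi \o model_projection psi].

(* Main.v *)
Require Import Defs.
From HB Require Import structures.
From mathcomp Require Import all_boot all_order all_algebra finmap.
From mathcomp Require Import cyclic separable cyclotomic complex ring lra.
From mathcomp Require Import all_classical all_reals all_analysis.
From mathcomp.analysis.showcase Require summability.

Set Implicit Arguments.
Unset Strict Implicit.
Unset Printing Implicit Defensive.
Import Order.TTheory GRing.Theory Num.Theory.
Import numFieldNormedType.Exports.
Local Open Scope classical_set_scope.
Local Open Scope complex_scope.
Local Open Scope ring_scope.

(** Suppose that T = P_phi P_psi, where P_phi is the projection onto the model
space Q_phi = (phi H^2)^perp.  Projections are self-adjoint, so T has the adjoint
P_psi P_phi, which kills phi H^2: hence phi lies in J_T, and likewise psi lies in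
J_(T* ).  The gcd psiT therefore divides phi, which gives phi H^2 <= psiT H^2
([mult_range_divides]) and so Q_psiT <= Q_phi; in the same way Q_psiTadj <= Q_psi.
Since two gcds of J_T divide each other and one of them lies in J_T, the operator
T^* kills psiT H^2 ([gcd_in_ker]): the range of T is orthogonal to psiT H^2, hence
contained in Q_psiT, and dually T f only depends on p = P_psiTadj f.  So
T f = T p = P_psiT T p = P_psiT P_phi P_psi p = P_psiT p,
the last step because p is in Q_psiTadj <= Q_psi and Q_psiT <= Q_phi.

Two facts carry this argument.

The first is that orthogonal projections onto orthogonal complements exist in H^2
([projection_exists]).  Taylor coefficients identify H^2 with the square summable
families, which are complete ([H2_complete]); the projection is then the limit of
a minimizing sequence.

The second is that theta f belongs to H^2 for theta in H^infty and f in H^2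
([Hinfty_mul]), which is what turns divisibility into an inclusion of ranges.
Analyticity being local, theta must first be expanded in one power series on the
whole polydisc ([expands_at_polydisc]): if theta is bounded by M, all its local
expansions with centre in a fixed closed polydisc converge at a common radius, and
the Cauchy estimates for these expansions, together with those for the expansion at
the origin, force the latter to converge on a larger polydisc
([coefficient_growth]).  The expansion of theta f is the Cauchy product
([expands_mul]), and its coefficients are square summable by [parseval_le].

The lemma [parseval_le] is the only source of estimates on coefficients: if
|g| <= M |f| on the torus then the coefficients satisfy
sum |c_k|^2 <= M^2 sum |d_k|^2.  Integration over the torus is replaced by averages
over the N-th roots of unity in each variable, which are exact on polynomials of
degree less than N in each variable.  With f = 1 this is the Cauchy estimate, and
with M = 0 it gives the uniqueness of power series coefficients. *)


(** * Sums over multi-indices *)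

Local Notation normc := Normc.normc.

Section Modulus.
Variable R : realType.
Implicit Types x y : R[i].

(** The norm of R[i] takes its values in R[i]; estimates are carried out with the
real-valued modulus instead. *)
Lemma normrcE x : `|x| = (normc x)%:C.
Proof. by rewrite normc_def; case: x. Qed.

Lemma normc_ge0 x : 0 <= normc x.
Proof. by rewrite -lecR -normrcE; exact: normr_ge0. Qed.

Lemma normc_real (r : R) : normc r%:C = `|r|.
Proof. by rewrite /normc /= expr0n /= addr0 sqrtr_sqr. Qed.

Lemma normcX x n : normc (x ^+ n) = normc x ^+ n.
Proof. by elim: n => [|n IH]; rewrite ?expr0 ?Normc.normc1// !exprS Normc.normcM IH. Qed.

Lemma normc_conj x : normc x^* = normc x.
Proof. by case: x => a b; rewrite /normc /= sqrrN. Qed.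

Lemma normc_distC x y : normc (x - y) = normc (y - x).
Proof. by rewrite -normcN opprB. Qed.

Lemma le_normcB x y : normc (x - y) <= normc x + normc y.
Proof. by rewrite -[in leRHS](normcN y) le_normcD. Qed.

Lemma Re_le_normc x : `|complex.Re x| <= normc x.
Proof.
case: x => a b /=; rewrite -(ger0_norm (sqrtr_ge0 _)) -ler_sqr ?nnegrE//.
by rewrite !real_normK ?num_real// sqr_sqrtr ?addr_ge0 ?sqr_ge0// lerDl sqr_ge0.
Qed.

Lemma Im_le_normc x : `|complex.Im x| <= normc x.
Proof.
case: x => a b /=; rewrite -(ger0_norm (sqrtr_ge0 _)) -ler_sqr ?nnegrE//.
by rewrite !real_normK ?num_real// sqr_sqrtr ?addr_ge0 ?sqr_ge0// lerDr sqr_ge0.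
Qed.

Lemma normc_le_ReIm x : normc x <= `|complex.Re x| + `|complex.Im x|.
Proof.
have -> : x = (complex.Re x)%:C + 'i%C * (complex.Im x)%:C by exact: complexE.
apply: le_trans (le_normcD _ _) _; rewrite Normc.normcM !normc_real.
have -> : normc ('i%C : R[i]) = 1 by rewrite /normc /= expr0n /= expr1n add0r sqrtr1.
case: x => a b; rewrite mul1r; simpc => /=.
by rewrite ?(mul0r, mulr0, mul1r, addr0, add0r, subr0, oppr0).
Qed.

Lemma normc_sqrE x : (normc x ^+ 2)%:C = x * x^*.
Proof. by rewrite rmorphXn /= -normrcE sqr_normc. Qed.

Lemma le_normc_sum (I : Type) (s : seq I) (P : pred I) (F : I -> R[i]) :
  normc (\sum_(i <- s | P i) F i) <= \sum_(i <- s | P i) normc (F i).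
Proof.
elim/big_ind2: _ => // [|a b c d ha hc]; first by rewrite Normc.normc0.
exact: le_trans (le_normcD _ _) (lerD ha hc).
Qed.

Lemma normc_prod (I : Type) (s : seq I) (P : pred I) (F : I -> R[i]) :
  normc (\prod_(i <- s | P i) F i) = \prod_(i <- s | P i) normc (F i).
Proof. exact: (big_morph _ (@Normc.normcM R) (Normc.normc1 R)). Qed.

End Modulus.

Section FsetSums.
Variables (K : choiceType).
Implicit Types A B : {fset K}.

Lemma big_fsetUD (V : nmodType) A B (F : K -> V) : (A `<=` B)%fset ->
  \sum_(k <- B) F k = \sum_(k <- A) F k + \sum_(k <- (B `\` A)%fset) F k.
Proof.
move=> AB; rewrite (big_fsetID _ (mem A)) /=; congr (_ + _); apply: eq_fbigl => k;
  rewrite !inE /=.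
  by case: (boolP (k \in A)) => [/(fsubsetP AB) ->|]; rewrite ?andbF.
by rewrite andbC.
Qed.

Lemma big_fset_sub_le (R : numDomainType) A B (F : K -> R) :
  (forall k, 0 <= F k) -> (A `<=` B)%fset ->
  \sum_(k <- A) F k <= \sum_(k <- B) F k.
Proof. by move=> F0 AB; rewrite (big_fsetUD _ AB) lerDl sumr_ge0. Qed.

Lemma fsetUDl_disjoint A B : [disjoint B & A]%fset -> ((A `|` B) `\` A = B)%fset.
Proof.
move=> dB; apply/fsetP => k; rewrite !inE.
by case: (boolP (k \in B)) => [/(fdisjointP dB) ->//|_]; case: (k \in A).
Qed.

End FsetSums.

Section RealSums.
Variables (R : realType) (K : choiceType).
Implicit Types (u v : K -> R) (A B : {fset K}).

Definition real_has_sum u (s : R) := forall e, 0 < e ->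
  exists A0, forall A, (A0 `<=` A)%fset -> `|s - \sum_(k <- A) u k| < e.

Lemma real_has_sumB u v s t : real_has_sum u s -> real_has_sum v t ->
  real_has_sum (fun k => u k - v k) (s - t).
Proof.
move=> us vt e e0; have e20 : 0 < e / 2 by rewrite divr_gt0.
have [A HA] := us _ e20; have [B HB] := vt _ e20.
exists (A `|` B)%fset => C; rewrite fsubUset => /andP[AC BC].
rewrite big_split /= sumrN.
have := HA _ AC; have := HB _ BC; rewrite !ltr_norml => /andP[? ?] /andP[? ?].
apply/andP; split; lra.
Qed.

Lemma real_has_sum_ge0 u (B : R) : (forall k, 0 <= u k) ->
  (forall A, \sum_(k <- A) u k <= B) ->
  exists s, [/\ real_has_sum u s, forall A, \sum_(k <- A) u k <= s & s <= B].
Proof.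
move=> u0 uB; pose E := [set \sum_(k <- A) u k | A in [set: {fset K}]].
have Eb : ubound E B by move=> _ [A _ <-]; exact: uB.
have E0 : E !=set0 by exists (\sum_(k <- fset0) u k), fset0.
have ubE : has_ubound E by exists B.
have hs : has_sup E by [].
have le A : \sum_(k <- A) u k <= sup E by apply: ub_le_sup => //; exists A.
exists (sup E); split => //; last exact: ge_sup.
move=> e e0; have [_ [A _ <-] HA] := sup_adherent e0 hs.
exists A => C AC; rewrite ger0_norm ?subr_ge0 ?le//.
have := big_fset_sub_le u0 AC; lra.
Qed.

(** u is the difference of the nonnegative families u + |u| and |u|, both with
bounded partial sums. *)
Lemma real_has_sum_abs u (B : R) : (forall A, \sum_(k <- A) `|u k| <= B) ->
  exists s, real_has_sum u s.
Proof.
move=> uB.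
have [s [us _ _]] := real_has_sum_ge0 (fun k => normr_ge0 (u k)) uB.
have [||t [ut _ _]] := @real_has_sum_ge0 (fun k => u k + `|u k|) (B + B).
- by move=> k; rewrite -lerBlDr sub0r lerNl; have := lerNnormlW (lexx `|u k|); lra.
- move=> A; rewrite big_split /= lerD//; apply: le_trans (uB A).
  by apply: ler_sum => k _; exact: ler_norm.
exists (t - s); have := real_has_sumB ut us.
by under eq_fun do rewrite addrK.
Qed.

(** The indices outside A0 split into those with u >= 0 and those with u < 0; over
each of these two parts a bound on the sum is a bound on the sum of the norms. *)
Lemma sum_norm_le_of_tail u A0 (b : R) :
  (forall A, [disjoint A & A0]%fset -> `|\sum_(k <- A) u k| <= b) ->
  forall A, \sum_(k <- A) `|u k| <= b + b + \sum_(k <- A0) `|u k|.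
Proof.
move=> H A.
apply: (@le_trans _ _ (\sum_(k <- (A `\` A0)%fset) `|u k| + \sum_(k <- A0) `|u k|)).
  rewrite addrC; apply: (@le_trans _ _ (\sum_(k <- (A0 `|` A)%fset) `|u k|)).
    by apply: big_fset_sub_le => //; exact: fsubsetUr.
  rewrite (big_fsetUD _ (fsubsetUl A0 A)) lerD2l.
  apply: big_fset_sub_le => //; apply/fsubsetP => k; rewrite !inE.
  by case: (k \in A0).
rewrite lerD2r; set D := (_ `\` _)%fset.
rewrite (big_fsetID _ (fun k => 0 <= u k)) /=.
set D1 := [fset _ | _ in _ & _]%fset; set D2 := [fset _ | _ in _ & _]%fset.
have dj (D' : {fset K}) : (forall k, k \in D' -> k \in D) -> [disjoint D' & A0]%fset.
  move=> h; apply/fdisjointP => k /h; rewrite !inE => /andP[]//.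
apply: lerD.
  apply: le_trans (H D1 _); last by apply: dj => k; rewrite !inE => /andP[].
  apply: le_trans (ler_norm _); rewrite big_seq [leRHS]big_seq; apply: ler_sum => k.
  by rewrite !inE => /andP[_ u0]; rewrite ger0_norm.
apply: le_trans (H D2 _); last by apply: dj => k; rewrite !inE => /andP[].
rewrite -normrN; apply: le_trans (ler_norm _).
rewrite -sumrN big_seq [leRHS]big_seq; apply: ler_sum => k.
by rewrite !inE => /andP[_]; rewrite -ltNge => u0; rewrite ltr0_norm.
Qed.

End RealSums.

(** Absolute convergence, stated through finite partial sums so that the bound is
a plain real number. *)
Definition abs_bound (R : realType) n (u : multi_index n -> R[i]^o) (B : R) :=
  forall A : {fset multi_index n}, \sum_(k <- A) normc (u k) <= B.

Section HasSum.
Variables (R : realType) (n : nat).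
Implicit Types (u v : multi_index n -> R[i]^o) (s t : R[i]^o) (A : {fset multi_index n}).

Lemma has_sumP u (s : R[i]^o) : has_sum u s <-> forall e : R, 0 < e ->
  exists A0, forall A, (A0 `<=` A)%fset -> normc (s - \sum_(k <- A) u k) < e.
Proof.
have psE A : summability.partial_sum u A = \sum_(k <- A) u k.
  by rewrite /summability.partial_sum big_seq_fsetE.
split.
  move=> us e e0.
  have ec : 0 < e%:C by rewrite ltcR.
  have /cvgrPdist_lt/(_ _ ec) := us.
  case=> A0 _ HA; exists A0 => A /HA /=.
  by rewrite normrcE ltcR psE.
move=> H; apply/cvgrPdist_lt => -[e ei]; rewrite ltcE /= => /andP[/eqP -> e0].
have [A0 HA] := H _ e0; exists A0 => // A /HA /=.
by rewrite -psE -ltcR -normrcE.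
Qed.

Lemma has_sum_uniq u (s t : R[i]^o) : has_sum u s -> has_sum u t -> s = t.
Proof.
by move=> us ut; apply: (@cvg_unique _ (@norm_hausdorff _ _) (summability.partial_sum u @ summability.totally)) us ut.
Qed.

Lemma abs_bound_ge0 u B : abs_bound u B -> 0 <= B.
Proof. by move/(_ fset0); rewrite big_nil. Qed.

(** Unconditional convergence bounds all finite sums off some A0, so the real and
imaginary parts fall under [sum_norm_le_of_tail]. *)
Lemma has_sum_abs u s : has_sum u s -> exists B, abs_bound u B.
Proof.
move=> /has_sumP /(_ _ ltr01)[A0 HA].
have H A : [disjoint A & A0]%fset -> normc (\sum_(k <- A) u k) <= 2.
  move=> dA; have := HA A0 (fsubset_refl _).
  have := HA _ (fsubsetUl A0 A).
  rewrite (big_fsetUD _ (fsubsetUl A0 A)).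
  rewrite (fsetUDl_disjoint dA).
  set a := \sum_(k <- A0) _; set b := \sum_(k <- A) _ => h1 h2.
  have -> : b = (s - a) - (s - (a + b)) by ring.
  by apply: le_trans (le_normcB _ _) _; lra.
have sumRe A : complex.Re (\sum_(k <- A) u k) = \sum_(k <- A) complex.Re (u k).
  by apply: (big_morph (@complex.Re R) _ _) => // -[? ?] [].
have sumIm A : complex.Im (\sum_(k <- A) u k) = \sum_(k <- A) complex.Im (u k).
  by apply: (big_morph (@complex.Im R) _ _) => // -[? ?] [].
have HR := @sum_norm_le_of_tail R _ (fun k => complex.Re (u k)) A0 2.
have HI := @sum_norm_le_of_tail R _ (fun k => complex.Im (u k)) A0 2.
eexists => A.
apply: le_trans (_ : \sum_(k <- A) (`|complex.Re (u k)| + `|complex.Im (u k)|) <= _).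
  by apply: ler_sum => k _; exact: normc_le_ReIm.
rewrite big_split /=; apply: lerD; first apply: HR; last apply: HI.
  by move=> C /H; rewrite -sumRe; apply: le_trans; exact: Re_le_normc.
by move=> C /H; rewrite -sumIm; apply: le_trans; exact: Im_le_normc.
Qed.

Lemma abs_has_sum u B : abs_bound u B -> exists s, has_sum u s.
Proof.
move=> uB.
have [|s hs] := @real_has_sum_abs R _ (fun k => complex.Re (u k)) B.
  by move=> A; apply: le_trans (uB A); apply: ler_sum => k _; exact: Re_le_normc.
have [|t ht] := @real_has_sum_abs R _ (fun k => complex.Im (u k)) B.
  by move=> A; apply: le_trans (uB A); apply: ler_sum => k _; exact: Im_le_normc.
exists (s +i* t); apply/has_sumP => e e0; have e20 : 0 < e / 2 by rewrite divr_gt0.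
have [A1 H1] := hs _ e20; have [A2 H2] := ht _ e20.
exists (A1 `|` A2)%fset => A; rewrite fsubUset => /andP[/H1 {}H1 /H2 {}H2].
apply: le_lt_trans (normc_le_ReIm _) _.
have -> : \sum_(k <- A) u k =
    (\sum_(k <- A) complex.Re (u k)) +i* (\sum_(k <- A) complex.Im (u k)).
  elim/big_rec3: _ => [//|k y1 y2 _ _ ->]; case: (u k) => a b; by simpc.
by rewrite /= [ltRHS]splitr; apply: ltrD.
Qed.

Lemma has_sum_le u s B : abs_bound u B -> has_sum u s -> normc s <= B.
Proof.
move=> uB /has_sumP us; apply/ler_addgt0Pr => e /us[A0 /(_ _ (fsubset_refl _))] h.
have -> : s = (s - \sum_(k <- A0) u k) + \sum_(k <- A0) u k by rewrite subrK.
apply: le_trans (le_normcD _ _) _; rewrite addrC lerD// ?(ltW h)//.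
exact: le_trans (le_normc_sum _ _ _) (uB _).
Qed.

Lemma abs_bound_tail u B : abs_bound u B -> forall e, 0 < e ->
  exists A0, forall A, [disjoint A & A0]%fset -> \sum_(k <- A) normc (u k) <= e.
Proof.
move=> uB e e0.
have [s [us us' _]] := real_has_sum_ge0 (fun k => normc_ge0 (u k)) uB.
(* the supremum of the finite sums is almost attained on A0 *)
have [A0 HA] := us _ e0; exists A0 => A dA.
have := HA _ (fsubset_refl _); have := us' (A0 `|` A)%fset.
rewrite (big_fsetUD _ (fsubsetUl A0 A)).
rewrite (fsetUDl_disjoint dA).
rewrite ltr_norml => h /andP[_]; lra.
Qed.

Lemma has_sum_tail u s A0 (e : R) : has_sum u s ->
  (forall A, [disjoint A & A0]%fset -> \sum_(k <- A) normc (u k) <= e) ->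
  normc (s - \sum_(k <- A0) u k) <= e.
Proof.
move=> /has_sumP us H; apply/ler_addgt0Pr => d d0; have [A1 HA] := us _ d0.
have := HA _ (fsubsetUr A0 A1); rewrite (big_fsetUD _ (fsubsetUl A0 A1)).
set a := \sum_(k <- A0) _; set b := \sum_(k <- _) _ => h.
have -> : s - a = (s - (a + b)) + b by ring.
apply: le_trans (le_normcD _ _) _; rewrite addrC lerD// ?(ltW h)//.
apply: le_trans (le_normc_sum _ _ _) (H _ _).
by apply/fdisjointP => k; rewrite !inE => /andP[].
Qed.

Lemma eq_has_sum u v s : u =1 v -> has_sum u s -> has_sum v s.
Proof. by move=> /funext ->. Qed.

Lemma has_sumZ u s (x : R[i]) : has_sum u s -> has_sum (fun k => x * u k) (x * s).
Proof.
move=> us; have := has_sumZD (x := x) us (@has_sum0 R n).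
by rewrite addr0; apply: eq_has_sum => k; rewrite addr0.
Qed.

Lemma has_sumD u v s t : has_sum u s -> has_sum v t ->
  has_sum (fun k => u k + v k) (s + t).
Proof.
move=> us vt; have := has_sumZD (x := 1) us vt.
by rewrite scale1r; apply: eq_has_sum => k; rewrite scale1r.
Qed.

Lemma has_sumB u v s t : has_sum u s -> has_sum v t ->
  has_sum (fun k => u k - v k) (s - t).
Proof.
move=> us vt; have := has_sumZD (x := -1) vt us.
by rewrite scaleN1r addrC; apply: eq_has_sum => k; rewrite scaleN1r addrC.
Qed.

Lemma has_sum_conj u s : has_sum u s -> has_sum (fun k => (u k)^* : R[i]^o) (s^*).
Proof.
move=> /has_sumP us; apply/has_sumP => e /us[A0 HA]; exists A0 => A /HA.
by rewrite -normc_conj rmorphB /= rmorph_sum.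
Qed.

Lemma has_sum_sum (J : Type) (r : seq J) (u : J -> multi_index n -> R[i]^o)
    (s : J -> R[i]^o) : (forall j, has_sum (u j) (s j)) ->
  has_sum (fun k => \sum_(j <- r) u j k) (\sum_(j <- r) s j).
Proof.
move=> us; elim: r => [|j r IH].
  rewrite big_nil; apply: eq_has_sum (@has_sum0 R n) => k.
  by rewrite big_nil.
rewrite big_cons; apply: eq_has_sum (has_sumD (us j) IH) => k.
by rewrite big_cons.
Qed.

Lemma has_sum_fin u A0 : (forall k, k \notin A0 -> u k = 0) ->
  has_sum u (\sum_(k <- A0) u k).
Proof.
move=> u0; apply/has_sumP => e e0; exists A0 => A sA.
rewrite (big_fsetUD _ sA) [X in normc (_ - (_ + X))]big1_seq ?addr0 ?subrr ?Normc.normc0//.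
by move=> k; rewrite !inE => /andP[_ /andP[/u0]].
Qed.

Lemma abs_boundW u v B : abs_bound v B -> (forall k, normc (u k) <= normc (v k)) ->
  abs_bound u B.
Proof. by move=> vB uv A; apply: le_trans (vB A); apply: ler_sum. Qed.

(** Some finite rectangle F0 x G0 carries all but e/5 of the absolute mass, so the
sums over any larger rectangle agree with its sum up to e/5; both iterated sums are
limits of sums over rectangles. *)
Lemma fubini (w : multi_index n -> multi_index n -> R[i]^o)
    (r c : multi_index n -> R[i]^o) (S : R[i]^o) (B : R) :
  (forall F G : {fset multi_index n}, \sum_(i <- F) \sum_(j <- G) normc (w i j) <= B) ->
  (forall i, has_sum (w i) (r i)) -> (forall j, has_sum (w ^~ j) (c j)) ->
  has_sum r S -> has_sum c S.
Proof.
move=> wB wr wc rS; apply/has_sumP => e e0.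
have e50 : 0 < e / 5 by rewrite divr_gt0.
have w0 i j : 0 <= normc (w i j) by exact: normc_ge0.
pose N (F G : {fset multi_index n}) := \sum_(i <- F) \sum_(j <- G) normc (w i j).
pose D (F G : {fset multi_index n}) := \sum_(i <- F) \sum_(j <- G) w i j.
have [F0 [G0 HN]] : exists F0 G0, forall F G, N F G < N F0 G0 + e / 5.
  pose E := [set N p.1 p.2 | p in [set: {fset multi_index n} * {fset multi_index n}]].
  have ubE : has_ubound E by exists B => _ [p _ <-]; exact: wB.
  have hs : has_sup E by split => //; exists (N fset0 fset0), (fset0, fset0).
  have [_ [[F0 G0] _ <-] H] := sup_adherent e50 hs.
  exists F0, G0 => F G; rewrite -ltrBlDr; apply: le_lt_trans H.
  by rewrite lerD2r; apply: ub_le_sup => //; exists (F, G).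
have close F G : (F0 `<=` F)%fset -> (G0 `<=` G)%fset -> normc (D F G - D F0 G0) <= e / 5.
  move=> sF sG; have := HN F G; rewrite /D /N !(big_fsetUD _ sF) /=.
  under [X in X + _ < _]eq_bigr do rewrite (big_fsetUD _ sG).
  under [in X in _ -> X]eq_bigr do rewrite (big_fsetUD _ sG).
  rewrite !big_split /=.
  set a := (\sum_(i <- F0) _); set b := (\sum_(i <- F0) _); set d := (\sum_(i <- _) _).
  set a' := (\sum_(i <- F0) _); set b' := (\sum_(i <- F0) _); set d' := (\sum_(i <- _) _).
  move=> h; have -> : a' + b' + d' - a' = b' + d' by ring.
  apply: le_trans (le_normcD _ _) _.
  have hb : normc b' <= b.
    by apply: le_trans (le_normc_sum _ _ _) _; apply: ler_sum => i _; exact: le_normc_sum.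
  have hd : normc d' <= d.
    by apply: le_trans (le_normc_sum _ _ _) _; apply: ler_sum => i _; exact: le_normc_sum.
  lra.
have Sclose : normc (S - D F0 G0) < 3 * (e / 5).
  have /has_sumP/(_ _ e50)[F1 H1] := rS.
  pose F := (F0 `|` F1)%fset; have {}H1 := H1 F (fsubsetUr _ _).
  have /has_sumP/(_ _ e50)[G1 H2] : has_sum (fun j => \sum_(i <- F) w i j) (\sum_(i <- F) r i).
    exact: (@has_sum_sum _ F w r wr).
  have {H2} := H2 _ (fsubsetUr G0 G1); have := close F _ (fsubsetUl _ _) (fsubsetUl G0 G1).
  rewrite exchange_big /= -/(D _ _) => h3 h2.
  have -> : S - D F0 G0 = (S - \sum_(i <- F) r i) + ((\sum_(i <- F) r i - D F (G0 `|` G1)%fset)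
     + (D F (G0 `|` G1)%fset - D F0 G0)) by ring.
  have := le_normcD (S - \sum_(i <- F) r i) ((\sum_(i <- F) r i - D F (G0 `|` G1)%fset)
     + (D F (G0 `|` G1)%fset - D F0 G0)).
  have := le_normcD (\sum_(i <- F) r i - D F (G0 `|` G1)%fset)
     (D F (G0 `|` G1)%fset - D F0 G0).
  lra.
exists G0 => G sG.
have /has_sumP/(_ _ e50)[F1 H1] : has_sum (fun i => \sum_(j <- G) w i j) (\sum_(j <- G) c j).
  exact: (@has_sum_sum _ G (fun j i => w i j) c wc).
have {}H1 := H1 _ (fsubsetUr F0 F1); rewrite -/(D _ _) in H1.
have h2 := close _ G (fsubsetUl F0 F1) sG.
set F := (F0 `|` F1)%fset in H1 h2.
set C := \sum_(j <- G) _ in H1 *.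
have -> : S - C = (S - D F0 G0) - ((C - D F G) + (D F G - D F0 G0)) by ring.
apply: le_lt_trans (le_normcB _ _) _.
have := le_normcD (C - D F G) (D F G - D F0 G0).
lra.
Qed.

End HasSum.

(** * Monomials, roots of unity and the Parseval inequality *)

Definition monomial (S : comPzRingType) n (x : 'I_n -> S) (k : multi_index n) : S :=
  \prod_i x i ^+ k i.

Section Monomial.
Variables (S : comNzRingType) (n : nat).
Implicit Types (x y : 'I_n -> S) (k : multi_index n).

Lemma monomialM x y k : monomial (fun i => x i * y i) k = monomial x k * monomial y k.
Proof. by rewrite /monomial -big_split; apply: eq_bigr => i _; rewrite exprMn. Qed.

Lemma monomialD x k k' : monomial x [ffun i => (k i + k' i)%N] = monomial x k * monomial x k'.
Proof. by rewrite /monomial -big_split; apply: eq_bigr => i _; rewrite ffunE exprD. Qed.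

Lemma monomial1 k : monomial (fun=> 1 : S) k = 1.
Proof. by rewrite /monomial big1 // => i _; rewrite expr1n. Qed.

End Monomial.

Lemma normc_monomial (R : realType) n (x : 'I_n -> R[i]) k :
  normc (monomial x k) = monomial (fun i => normc (x i)) k.
Proof. by rewrite normc_prod; apply: eq_bigr => i _; rewrite normcX. Qed.

Lemma conj_monomial (R : realType) n (x : 'I_n -> R[i]) k :
  (monomial x k)^* = monomial (fun i => (x i)^*) k.
Proof. by rewrite rmorph_prod; apply: eq_bigr => i _; rewrite rmorphXn. Qed.

Lemma monomial_ge0 (R : numDomainType) n (x : 'I_n -> R) k :
  (forall i, 0 <= x i) -> 0 <= monomial x k.
Proof. by move=> x0; apply: prodr_ge0 => i _; rewrite exprn_ge0. Qed.

Lemma ler_monomial (R : numDomainType) n (x y : 'I_n -> R) k :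
  (forall i, 0 <= x i <= y i) -> monomial x k <= monomial y k.
Proof.
move=> xy; apply: ler_prod => i _; have /andP[x0 xyi] := xy i.
by rewrite exprn_ge0//= lerXn2r ?nnegrE// (le_trans x0).
Qed.

Section Box.
Variable n : nat.

(** Multi-indices with all entries below L are indexed by a finite type, over
which products of sums expand with [bigA_distr_bigA]. *)
Definition index_of_ord L (t : {ffun 'I_n -> 'I_L}) : multi_index n :=
  [ffun i => val (t i)].

Definition box L : {fset multi_index n} :=
  [fset index_of_ord t | t in {: {ffun 'I_n -> 'I_L}}]%fset.

Lemma index_of_ord_inj L : injective (@index_of_ord L).
Proof.
move=> t t' /ffunP h; apply/ffunP => i; apply: val_inj.
by have := h i; rewrite !ffunE.
Qed.

Lemma big_box (V : nmodType) L (F : multi_index n -> V) :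
  \sum_(k <- box L) F k = \sum_(t : {ffun 'I_n -> 'I_L}) F (index_of_ord t).
Proof.
rewrite /box big_imfset /=; last by move=> ? ? _ _ /=; exact: index_of_ord_inj.
by rewrite big_enum.
Qed.

Lemma in_box L (k : multi_index n) : (k \in box L) = [forall i, (k i < L)%N].
Proof.
apply/imfsetP/forallP => [[t _ ->] i|h].
  by rewrite ffunE ltn_ord.
exists [ffun i => Ordinal (h i)] => //; apply/ffunP => i.
by rewrite !ffunE.
Qed.

Lemma box_sub L L' : (L <= L')%N -> (box L `<=` box L')%fset.
Proof.
move=> LL; apply/fsubsetP => k; rewrite !in_box => /forallP h.
by apply/forallP => i; apply: leq_trans (h i) LL.
Qed.

Lemma fset_sub_box (A : {fset multi_index n}) : exists L, (A `<=` box L)%fset.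
Proof.
exists (\sum_(k <- A) \sum_i k i).+1; apply/fsubsetP => k kA.
rewrite in_box; apply/forallP => i; rewrite ltnS.
rewrite (big_rem k) //= (bigD1 i) //=.
by rewrite -addnA leq_addr.
Qed.

Lemma abs_bound_tail_box (R : realType) (u : multi_index n -> R[i]^o) B e :
  abs_bound u B -> 0 < e -> exists L, forall L', (L <= L')%N ->
  forall A, [disjoint A & box L']%fset -> \sum_(k <- A) normc (u k) <= e.
Proof.
move=> uB /(abs_bound_tail uB)[A0 H]; have [L AL] := fset_sub_box A0.
exists L => L' LL A dA; apply: H; apply: fdisjointWr dA.
exact: fsubset_trans AL (box_sub LL).
Qed.

Lemma sum_box_monomial (S : comNzRingType) L (x : 'I_n -> S) :
  \sum_(k <- box L) monomial x k = \prod_i \sum_(j < L) x i ^+ j.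
Proof.
rewrite big_box bigA_distr_bigA; apply: eq_bigr => t _.
by apply: eq_bigr => i _; rewrite ffunE.
Qed.

(** Over a box the sum factors into a product of finite geometric sums. *)
Lemma sum_monomial_le (R : realFieldType) (x : 'I_n -> R) (A : {fset multi_index n}) :
  (forall i, 0 <= x i < 1) -> \sum_(k <- A) monomial x k <= \prod_i (1 - x i)^-1.
Proof.
move=> x01; have [L AL] := fset_sub_box A.
have x0 i : 0 <= x i by have /andP[] := x01 i.
apply: le_trans (big_fset_sub_le _ AL) _; first by move=> k; exact: monomial_ge0.
rewrite sum_box_monomial; apply: ler_prod => i _.
rewrite sumr_ge0 => [|j _]; last by rewrite exprn_ge0.
have x1 : 0 < 1 - x i by rewrite subr_gt0; have /andP[] := x01 i.
rewrite -(ler_pM2l x1) mulfV ?gt_eqF// -opprB mulNr -subrX1 opprB.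
by rewrite lerBlDr lerDl exprn_ge0.
Qed.

End Box.

Section RootsOfUnity.
Variable R : realType.

(** R[i] is algebraically closed and X^N - 1 is separable. *)
Lemma exists_prim_root N : (0 < N)%N -> {w : R[i] | N.-primitive_root w}.
Proof.
pose p : {poly R[i]} := 'X^N - 1; have [r Dp] := closed_field_poly_normal p.
move=> N0; apply/sigW; rewrite (monicP _) ?monicXnsubC // scale1r in Dp.
have rn1 : all N.-unity_root r by apply/allP => z; rewrite -root_prod_XsubC -Dp.
have sz_r : (N < (size r).+1)%N.
  by rewrite -(size_prod_XsubC r id) -Dp size_XnsubC.
have [|z] := hasP (has_prim_root N0 rn1 _ sz_r); last by exists z.
by rewrite -separable_prod_XsubC -Dp separable_Xn_sub_1 // pnatr_eq0 -lt0n.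
Qed.

Lemma prim_root_normc N (w : R[i]) : N.-primitive_root w -> normc w = 1.
Proof.
move=> pw; have N0 := prim_order_gt0 pw.
have := congr1 (@Normc.normc R) (prim_expr_order pw).
rewrite normcX Normc.normc1 => /eqP.
by rewrite pexpr_eq1 ?normc_ge0// => /eqP.
Qed.

(** The terms are the powers of w^a times the conjugate of w^b, an N-th root of
unity that is 1 only if a = b because a and b are below N. *)
Lemma sum_root_orth N (w : R[i]) (a b : 'I_N) : N.-primitive_root w ->
  \sum_(t < N) (w ^+ t) ^+ a * ((w ^+ t) ^+ b)^* = N%:R * (a == b)%:R.
Proof.
move=> pw; have w1 := prim_root_normc pw.
pose x := w ^+ a * (w ^+ b)^*.
have -> : \sum_(t < N) (w ^+ t) ^+ a * ((w ^+ t) ^+ b)^* = \sum_(t < N) x ^+ t.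
  apply: eq_bigr => t _; rewrite /x exprMn -!rmorphXn /=.
  by rewrite -!exprM mulnC (mulnC b).
have wJ m : w ^+ m * (w ^+ m)^* = 1 by rewrite -normc_sqrE normcX w1 !expr1n.
case: (eqVneq a b) => [ab|ab].
  rewrite mulr1 /x ab; under eq_bigr do rewrite wJ expr1n.
  by rewrite sumr_const card_ord.
rewrite mulr0; have xN : x ^+ N = 1.
  rewrite exprMn -rmorphXn /= -!exprM !(mulnC _ N) !exprM (prim_expr_order pw).
  by rewrite !expr1n mul1r rmorph1.
have x1 : x - 1 != 0.
  rewrite subr_eq0; apply: contraNneq ab => x1; apply/eqP/val_inj/eqP.
  have : w ^+ a = w ^+ b.
    by rewrite -[LHS]mulr1 -(wJ b) mulrCA -/x x1 mulr1.
  by move=> /eqP; rewrite (eq_prim_root_expr pw) !modn_small.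
by apply: (mulfI x1); rewrite mulr0 -subrX1 xN subrr.
Qed.

End RootsOfUnity.

Section Parseval.
Variables (R : realType) (n : nat).
Implicit Types (c d : multi_index n -> R[i]^o) (A : {fset multi_index n}).

Definition grid_point N (w : R[i]) (t : {ffun 'I_n -> 'I_N}) : 'I_n -> R[i] :=
  fun i => w ^+ t i.

Lemma grid_orth N (w : R[i]) (p q : {ffun 'I_n -> 'I_N}) : N.-primitive_root w ->
  \sum_(t : {ffun 'I_n -> 'I_N}) monomial (grid_point w t) (index_of_ord p) *
     (monomial (grid_point w t) (index_of_ord q))^* = (N ^ n)%:R * (p == q)%:R.
Proof.
move=> pw.
transitivity (\sum_(t : {ffun 'I_n -> 'I_N})
    \prod_i ((w ^+ t i) ^+ p i * ((w ^+ t i) ^+ q i)^*)).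
  apply: eq_bigr => t _; rewrite conj_monomial -big_split /=.
  by apply: eq_bigr => i _; rewrite !ffunE /grid_point [in RHS]rmorphXn.
rewrite -(bigA_distr_bigA (fun i (j : 'I_N) => (w ^+ j) ^+ p i * ((w ^+ j) ^+ q i)^*)).
under eq_bigr do rewrite sum_root_orth //.
rewrite big_split /= prodr_const card_ord natrX; congr (_ * _).
case: eqVneq => [->|pq]; first by rewrite big1 // => i _; rewrite eqxx.
have /existsP[i pqi] : [exists i, p i != q i].
  by rewrite -negb_forall; apply: contra pq => /forallP h; apply/eqP/ffunP => i; exact/eqP/h.
by rewrite (bigD1 i) //= (negbTE pqi) mul0r.
Qed.

(** For polynomials of degree below N in each variable, averaging over the N-th
roots of unity has the effect of integrating over the torus. *)
Lemma grid_parseval N (w : R[i]) c : N.-primitive_root w ->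
  \sum_(t : {ffun 'I_n -> 'I_N})
    normc (\sum_(k <- box n N) c k * monomial (grid_point w t) k) ^+ 2 =
  (N ^ n)%:R * \sum_(k <- box n N) normc (c k) ^+ 2.
Proof.
move=> pw; apply: (@complexI R); rewrite rmorph_sum rmorphM rmorph_nat rmorph_sum /=.
rewrite [in RHS]big_box.
transitivity (\sum_(t : {ffun 'I_n -> 'I_N}) \sum_(p : {ffun 'I_n -> 'I_N})
   \sum_(q : {ffun 'I_n -> 'I_N}) (c (index_of_ord p) * (c (index_of_ord q))^*) *
     (monomial (grid_point w t) (index_of_ord p) *
     (monomial (grid_point w t) (index_of_ord q))^*)).
  apply: eq_bigr => t _; rewrite normc_sqrE big_box rmorph_sum /= mulr_suml.
  apply: eq_bigr => p _; rewrite mulr_sumr; apply: eq_bigr => q _.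
  by rewrite rmorphM mulrACA.
rewrite exchange_big mulr_sumr /=; apply: eq_bigr => p _.
rewrite exchange_big /= (bigD1 p) //= [X in _ + X]big1 ?addr0.
  by rewrite -mulr_sumr grid_orth // eqxx mulr1 mulrC -normc_sqrE.
by move=> q qp; rewrite -mulr_sumr grid_orth // eq_sym (negbTE qp) !mulr0.
Qed.

(** Up to a small x both series are polynomials on a large box, where
[grid_parseval] is exact; the comparison on the grid points passes to the averages,
and the error is at most x K for a constant K. *)
Lemma parseval_le c d (M B1 B2 D : R) : 0 <= M -> abs_bound c B1 -> abs_bound d B2 ->
  (forall (z : 'I_n -> R[i]) (g f : R[i]^o), (forall i, normc (z i) = 1) ->
    has_sum (fun k => c k * monomial z k) g ->
    has_sum (fun k => d k * monomial z k) f -> normc g <= M * normc f) ->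
  (forall A, \sum_(k <- A) normc (d k) ^+ 2 <= D) ->
  forall A, \sum_(k <- A) normc (c k) ^+ 2 <= M ^+ 2 * D.
Proof.
move=> M0 cB dB H dD A; apply/ler_addgt0Pr => e e0.
have B20 := abs_bound_ge0 dB.
(* x K bounds (M |Q| + (M + 1) x)^2 - M^2 |Q|^2 for |Q| <= B2 and x <= 1 *)
pose K := (M + 1) * (2 * M * B2 + M + 1).
have K0 : 0 < K by rewrite /K mulr_gt0 //; first lra; have := mulr_ge0 M0 B20; lra.
pose x := Num.min 1 (e / K).
have x0 : 0 < x by rewrite /x lt_min ltr01 divr_gt0.
have x1 : x <= 1 by rewrite /x ge_min lexx.
have xe : x * K <= e by rewrite -ler_pdivlMr // /x ge_min lexx orbT.
have [L1 H1] := abs_bound_tail_box cB x0.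
have [L2 H2] := abs_bound_tail_box dB x0.
have [L3 H3] := fset_sub_box A.
pose N := (L1 + L2 + L3).+1.
have N1 : (L1 <= N)%N by rewrite /N leqW // -addnA leq_addr.
have N2 : (L2 <= N)%N by rewrite /N leqW // addnAC leq_addl.
have N3 : (L3 <= N)%N by rewrite /N leqW // leq_addl.
have [w pw] := exists_prim_root R (ltn0Sn (L1 + L2 + L3)).
rewrite -/N in pw.
have tail (u : multi_index n -> R[i]^o) (U : R) z : abs_bound u U ->
    (forall A, [disjoint A & box n N]%fset -> \sum_(k <- A) normc (u k) <= x) ->
    (forall i, normc (z i) = 1) -> exists2 s : R[i]^o, has_sum (fun k => u k * monomial z k) s &
    normc (s - \sum_(k <- box n N) u k * monomial z k) <= x.
  move=> uU ut z1.
  have nu k : normc (u k * monomial z k) = normc (u k).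
    rewrite Normc.normcM normc_monomial; under [X in monomial X]funext do rewrite z1.
    by rewrite monomial1 mulr1.
  have [|s us] := @abs_has_sum _ _ (fun k => u k * monomial z k) U.
    by apply: abs_boundW uU _ => k; rewrite nu.
  exists s => //; apply: has_sum_tail us _ => A' /ut.
  by under eq_bigr do rewrite -nu.
apply: le_trans (big_fset_sub_le _ (fsubset_trans H3 (box_sub n N3))) _.
  by move=> k; rewrite sqr_ge0.
have Nn0 : 0 < ((N ^ n)%:R : R) by rewrite ltr0n expn_gt0.
rewrite -(ler_pM2l Nn0) -(grid_parseval _ pw).
apply: le_trans (_ : \sum_(t : {ffun 'I_n -> 'I_N})
  (M ^+ 2 * normc (\sum_(k <- box n N) d k * monomial (grid_point w t) k) ^+ 2 + e) <= _).
  apply: ler_sum => t _.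
  have z1 i : normc (grid_point w t i) = 1.
    by rewrite /grid_point normcX (prim_root_normc pw) expr1n.
  have [g cg g1] := tail c B1 _ cB (H1 _ N1) z1.
  have [f df f1] := tail d B2 _ dB (H2 _ N2) z1.
  have := H _ _ _ z1 cg df.
  set P := \sum_(k <- _) c _ * _; set Q := \sum_(k <- _) d _ * _.
  rewrite -/P in g1; rewrite -/Q in f1 => gf.
  have QB : normc Q <= B2.
    apply: le_trans (le_normc_sum _ _ _) _; apply: le_trans (dB (box n N)).
    apply: ler_sum => k _; rewrite Normc.normcM normc_monomial.
    by under [X in monomial X]funext do rewrite z1; rewrite monomial1 mulr1.
  have PP : normc P <= M * normc Q + (M + 1) * x.
    have -> : P = g - (g - P) by ring.
    apply: le_trans (le_normcB _ _) _.
    have : normc f <= normc Q + x.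
      have -> : f = Q + (f - Q) by ring.
      by apply: le_trans (le_normcD _ _) _; rewrite lerD2l.
    move=> /(ler_wpM2l M0); lra.
  have Q0 := normc_ge0 Q; have P0 := normc_ge0 P.
  apply: le_trans (_ : (M * normc Q + (M + 1) * x) ^+ 2 <= _).
    by rewrite lerXn2r // nnegrE //; apply: le_trans PP.
  have -> : (M * normc Q + (M + 1) * x) ^+ 2 =
    M ^+ 2 * normc Q ^+ 2 + x * ((M + 1) * (2 * M * normc Q + (M + 1) * x)) by ring.
  rewrite lerD2l; apply: le_trans xe; rewrite ler_pM2l // /K ler_pM2l; last lra.
  have := ler_wpM2l M0 QB; have : (M + 1) * x <= M + 1 by rewrite ler_piMr //; lra.
  lra.
rewrite big_split /= -mulr_sumr (grid_parseval _ pw) sumr_const card_ffun !card_ord.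
rewrite -[e *+ _]mulr_natl mulrCA -mulrDr ler_pM2l // lerD2r ler_wpM2l ?sqr_ge0 //.
Qed.

(** [parseval_le] for the rescaled series and the constant series 1, keeping a
single term of the left-hand sum. *)
Lemma cauchy_estimate c (s M : R) : 0 <= s -> 0 <= M ->
  (forall z : 'I_n -> R[i], (forall i, normc (z i) = s) ->
    exists2 g : R[i]^o, has_sum (fun k => c k * monomial z k) g & normc g <= M) ->
  forall k, normc (c k) * monomial (fun=> s) k <= M.
Proof.
move=> s0 M0 H k.
(* absorbing s^k reduces to the unit torus; d is the constant series 1 *)
pose c' k : R[i]^o := c k * monomial (fun=> s%:C) k.
pose k0 : multi_index n := [ffun=> 0%N].
pose d (k : multi_index n) : R[i]^o := (k == k0)%:R.
have [|g0 /has_sum_abs[B1 cB] _] := H (fun=> s%:C).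
  by move=> i; rewrite normc_real ger0_norm.
have sumd A : \sum_(k <- A) normc (d k) <= 1.
  apply: le_trans (big_fset_sub_le _ (fsubsetUl A [fset k0]%fset)) _.
    by move=> ?; exact: normc_ge0.
  rewrite (big_fsetD1 k0) ?inE ?eqxx ?orbT //= /d eqxx Normc.normc1.
  rewrite big1_seq ?addr0 // => j /=; rewrite !inE => /andP[/negbTE -> _].
  by rewrite Normc.normc0.
have := @parseval_le c' d M B1 1 1 M0 cB sumd.
move=> /(_ _ _ [fset k]%fset); rewrite big_seq_fset1 mulr1 => main.
have {main} : normc (c' k) ^+ 2 <= M ^+ 2.
  apply: main.
    move=> z g f z1 cg df.
    have f1 : f = 1.
      apply: has_sum_uniq df _.
      have := @has_sum_fin _ _ (fun k => d k * monomial z k) [fset k0]%fset.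
      rewrite big_seq_fset1 /d eqxx mul1r /monomial big1; last by move=> i _; rewrite ffunE expr0.
      by apply => j; rewrite inE => /negbTE ->; rewrite mul0r.
    have [|g' cg' gM] := H (fun i => s%:C * z i).
      by move=> i; rewrite Normc.normcM z1 mulr1 normc_real ger0_norm.
    have -> : g = g'.
      apply: has_sum_uniq cg _; apply: eq_has_sum cg' => j.
      by rewrite monomialM /c' mulrA.
    by rewrite f1 Normc.normc1 mulr1.
  move=> A; apply: le_trans (sumd A); apply: ler_sum => j _.
  by rewrite /d; case: eqP; rewrite ?Normc.normc1 ?Normc.normc0 ?expr1n ?expr0n.
rewrite ler_sqr ?nnegrE ?normc_ge0 // /c' Normc.normcM normc_monomial.
by under [X in monomial X]funext do rewrite normc_real ger0_norm //.
Qed.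

End Parseval.

(** * Re-expansion of power series *)

(** The coefficient of y^m in the expansion of (x + y)^k; it vanishes unless m <= k,
through the binomial coefficients. *)
Definition shift_coef (S : comNzRingType) n (x : 'I_n -> S) (k m : multi_index n) : S :=
  \prod_i ('C(k i, m i)%:R * x i ^+ (k i - m i)).

Section ShiftCoef.
Variables (n : nat).
Implicit Types (k m : multi_index n).

Lemma shift_coef_out (S : comNzRingType) L (x : 'I_n -> S) k m : k \in box n L -> m \notin box n L ->
  shift_coef x k m = 0.
Proof.
rewrite !in_box negb_forall => /forallP kL mL0.
have [i mL] := existsP mL0; rewrite -leqNgt in mL.
rewrite /shift_coef (bigD1 i) //= bin_small ?mul0r //.
exact: leq_trans (kL i) mL.
Qed.

Lemma monomial_add (S : comNzRingType) L (x y : 'I_n -> S) k : k \in box n L ->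
  monomial (fun i => x i + y i) k = \sum_(m <- box n L) shift_coef x k m * monomial y m.
Proof.
rewrite in_box => /forallP kL; rewrite big_box.
under [RHS]eq_bigr => t _.
  rewrite -big_split /=.
  under eq_bigr do rewrite !ffunE.
over.
rewrite -(bigA_distr_bigA (fun i (j : 'I_L) =>
  'C(k i, j)%:R * x i ^+ (k i - j) * y i ^+ j)).
apply: eq_bigr => i _; rewrite exprDn.
rewrite (big_ord_widen L (fun j => x i ^+ (k i - j) * y i ^+ j *+ 'C(k i, j))) //.
rewrite big_mkcond /=; apply: eq_bigr => j _.
case: ltnP => [_|kj]; first by rewrite -mulrA mulr_natl.
by rewrite bin_small // !mul0r.
Qed.

Lemma normc_shift_coef (R : realType) (x : 'I_n -> R[i]) k m :
  normc (shift_coef x k m) = shift_coef (fun i => normc (x i)) k m.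
Proof.
rewrite normc_prod; apply: eq_bigr => i _.
rewrite Normc.normcM normcX; congr (_ * _).
by rewrite -(rmorph_nat (real_complex R)) normc_real ger0_norm.
Qed.

(** Turns the re-expanded coefficients into power series in the centre x, to which
Cauchy estimates apply. *)
Lemma shift_coef_monomial (S : comNzRingType) (x : 'I_n -> S) k m :
  shift_coef x k m * monomial x m = shift_coef (fun=> 1) k m * monomial x k.
Proof.
rewrite -!big_split /=; apply: eq_bigr => i _.
rewrite expr1n mulr1 -mulrA -exprD.
by case: (leqP (m i) (k i)) => [mk|km]; [rewrite subnK | rewrite bin_small // !mul0r].
Qed.

End ShiftCoef.

Lemma strict_bound_exists (R : realType) n (x : 'I_n -> R) (r : R) : 0 < r -> (forall i, x i < r) ->
  exists2 s, 0 < s < r & forall i, x i <= s.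
Proof.
move=> r0 xr.
pose s := \big[Num.max/(r / 2)]_i x i.
exists s; last by move=> i; exact: le_bigmax.
apply/andP; split; first by apply: lt_le_trans (bigmax_ge_id _ _ _ _); lra.
by apply: bigmax_lt => //; lra.
Qed.

Section PowerSeries.
Variables (R : realType) (n : nat).
Implicit Types (a b : multi_index n -> R[i]^o) (h c : 'I_n -> R[i]) (F : ('I_n -> R[i]) -> R[i]^o).

(** F is defined on all of C^n, so that nearby centres need no proof of membership
in the polydisc. *)
Definition expands_at F c (r : R) a := forall h, (forall i, normc (h i) < r) ->
  has_sum (fun k => a k * monomial h k) (F (fun i => c i + h i)).

(** The Cauchy estimate with bound 0 for the difference. *)
Lemma power_series_uniq a b (r : R) : 0 < r ->
  (forall h, (forall i, normc (h i) < r) -> exists2 v, has_sum (fun k => a k * monomial h k) v &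
     has_sum (fun k => b k * monomial h k) v) -> a = b.
Proof.
move=> r0 H; apply/funext => k; apply/eqP; rewrite -subr_eq0.
have r20 : 0 < r / 2 by rewrite divr_gt0.
have := @cauchy_estimate R n (fun k => a k - b k) (r / 2) 0 (ltW r20) (lexx 0).
move=> /(_ _ k) h; apply/eqP/Normc.eq0_normc/eqP.
rewrite eq_le normc_ge0 andbT.
have p0 : 0 < monomial (fun=> r / 2) k by apply: prodr_gt0 => i _; rewrite exprn_gt0.
rewrite -(ler_pM2r p0) mul0r; apply: h => z zr.
have [|v av bv] := H z; first by move=> i; rewrite zr; lra.
exists 0; last by rewrite Normc.normc0.
by rewrite -(subrr v); apply: eq_has_sum (has_sumB av bv) => j; rewrite mulrBl.
Qed.

Lemma expands_at_uniq F c r r' a b : 0 < r -> 0 < r' -> expands_at F c r a ->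
  expands_at F c r' b -> a = b.
Proof.
move=> r0 r'0 Fa Fb; apply: (@power_series_uniq _ _ (Num.min r r')).
  by rewrite lt_min r0 r'0.
move=> h hr; exists (F (fun i => c i + h i)); [apply: Fa|apply: Fb] => i;
by have := hr i; rewrite lt_min => /andP[].
Qed.

(** The double family a_k C(k,m) c'^(k-m) h^m sums to a_k (c' + h)^k over m and to
b_m h^m over k, and it is absolutely summable because a converges at the point with
coordinates |c'_i| + |h_i|. *)
Lemma recenter F c (r : R) a (c' : 'I_n -> R[i]) : 0 < r -> expands_at F c r a ->
  (forall i, normc (c' i) < r) ->
  exists b, (forall m, has_sum (fun k => a k * shift_coef c' k m) (b m)) /\
  forall h, (forall i, normc (c' i) + normc (h i) < r) ->
    has_sum (fun m => b m * monomial h m) (F (fun i => c i + (c' i + h i))).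
Proof.
move=> r0 Fa c'r.
have bnd h : (forall i, normc (c' i) + normc (h i) < r) -> exists B,
    forall A G : {fset multi_index n}, \sum_(k <- A) \sum_(m <- G)
      normc (a k * shift_coef c' k m * monomial h m) <= B.
  move=> hr.
  have [|B aB] := has_sum_abs (Fa (fun i => (normc (c' i) + normc (h i))%:C) _).
    by move=> i; rewrite normc_real ger0_norm // addr_ge0 ?normc_ge0.
  exists B => A G; have [L LAG] := fset_sub_box (A `|` G)%fset.
  move: LAG; rewrite fsubUset => /andP[AL GL].
  apply: le_trans (aB A).
  rewrite big_seq [leRHS]big_seq; apply: ler_sum => k kA.
  apply: le_trans (big_fset_sub_le _ GL) _; first by move=> m; exact: normc_ge0.
  under eq_bigr do rewrite !Normc.normcM -mulrA normc_shift_coef normc_monomial.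
  rewrite -mulr_sumr -monomial_add ?(fsubsetP AL) //.
  rewrite Normc.normcM normc_monomial.
  under [X in _ <= _ * monomial X _]funext do rewrite normc_real ger0_norm ?addr_ge0 ?normc_ge0 //.
  exact: lexx.
have [s /andP[s0 sr] c's] := strict_bound_exists r0 c'r.
(* a nonzero increment h, so that dividing by h^m makes sense *)
have [|B HB] := bnd (fun=> ((r - s) / 2)%:C).
  by move=> i; rewrite normc_real ger0_norm; have := c's i; lra.
have /choice[b ab] m : exists v : R[i]^o, has_sum (fun k => a k * shift_coef c' k m) v.
  have e0 : 0 < normc (monomial (fun=> ((r - s) / 2)%:C) m : R[i]).
    rewrite normc_monomial; apply: prodr_gt0 => i _; rewrite exprn_gt0 //.
    rewrite normc_real gtr0_norm; lra.
  apply: (@abs_has_sum _ _ _ (B / normc (monomial (fun=> ((r - s) / 2)%:C) m : R[i]))) => A.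
  rewrite ler_pdivlMr // mulr_suml.
  have := HB A [fset m]%fset.
  under eq_bigr do rewrite big_seq_fset1 Normc.normcM.
  by [].
exists b; split => // h hr.
have [B' HB'] := bnd h hr.
apply: (fubini HB' _ _ (Fa (fun i => c' i + h i) _)).
- move=> k; have [L /fsubsetP kL] := fset_sub_box [fset k]%fset.
  have {}kL : k \in box n L by apply: kL; rewrite inE.
  rewrite (monomial_add _ _ kL) mulr_sumr.
  under eq_bigr do rewrite mulrA.
  apply: has_sum_fin => m mL.
  by rewrite (shift_coef_out _ kL mL) mulr0 mul0r.
- move=> m /=; rewrite [b m * _]mulrC.
  apply: eq_has_sum (has_sumZ (x := monomial h m) (ab m)) => k.
  by rewrite mulrC.
- by move=> i; apply: le_lt_trans (hr i); exact: le_normcD.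
Qed.

End PowerSeries.

(** * Global expansion of bounded analytic functions *)

Section Continuation.
Variables (R : realType) (n : nat).
Implicit Types (a b : multi_index n -> R[i]^o) (h c : 'I_n -> R[i]) (F : ('I_n -> R[i]) -> R[i]^o).

Let origin : 'I_n -> R[i] := fun=> 0.

Lemma expands_atW F c (r r' : R) a : r' <= r -> expands_at F c r a -> expands_at F c r' a.
Proof. by move=> rr Fa h hr; apply: Fa => i; apply: lt_le_trans (hr i) rr. Qed.

Lemma expands_at_shift F c c' (r r' : R) a b : 0 < r -> expands_at F c r a ->
  (forall i, normc (c' i - c i) + r' <= r) ->
  (forall i, normc (c' i - c i) < r) ->
  (forall m, has_sum (fun k => a k * shift_coef (fun i => c' i - c i) k m) (b m)) ->
  expands_at F c' r' b.
Proof.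
move=> r0 Fa c'r c'r0 ab h hr.
have [b' [ab' Hb']] := recenter r0 Fa c'r0.
have -> : b = b' by apply/funext => m; exact: has_sum_uniq (ab m) (ab' m).
have -> : (fun i => c' i + h i) = (fun i => c i + ((c' i - c i) + h i)).
  by apply/funext => i; ring.
by apply: Hb' => i; have := hr i; have := c'r i; lra.
Qed.

Lemma expands_at_recenter F c c' (r r' : R) a : 0 < r -> expands_at F c r a ->
  (forall i, normc (c' i - c i) + r' <= r) ->
  (forall i, normc (c' i - c i) < r) ->
  exists2 b, (forall m, has_sum (fun k => a k * shift_coef (fun i => c' i - c i) k m) (b m)) &
  expands_at F c' r' b.
Proof.
move=> r0 Fa c'r c'r0; have [b [ab _]] := recenter r0 Fa c'r0.
by exists b => //; exact: (expands_at_shift r0 Fa c'r c'r0 ab).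
Qed.

(** The m-th coefficient b_m(c) of F at a centre c with |c_i| = s' < s is at most
M (d/2)^-m by the Cauchy estimate on a polydisc of radius d/2.  As a function of c,
c^m b_m(c) is the power series with coefficients a_k C(k,m), so a second Cauchy
estimate on |c_i| = s' gives |a_k| C(k,m) s'^(k-m) (d/2)^m <= M.  Multiplying by
2^-m and summing over m recovers |a_k| (s' + d/4)^k by the binomial theorem. *)
Lemma coefficient_growth F (M s d : R) a : 0 < d <= s -> (forall x, normc (F x) <= M) ->
  expands_at F origin s a ->
  (forall c, (forall i, normc (c i) < s) -> exists b, expands_at F c d b) ->
  forall k, normc (a k) * monomial (fun=> s + 3 * d / 16) k <= M * 2 ^+ n.
Proof.
move=> /andP[d0 ds] FM Fa Floc.
have M0 : 0 <= M by apply: le_trans (FM origin); exact: normc_ge0.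
(* staying strictly inside the polydisc of radius s leaves room to re-expand *)
pose s' := s - d / 16.
have s'0 : 0 < s' by rewrite /s'; lra.
have mono_gt0 (t : R) (m : multi_index n) : 0 < t -> 0 < monomial (fun=> t : R) m :> R.
  by move=> t0; apply: prodr_gt0 => i _; rewrite exprn_gt0.
have d20 : 0 < d / 2 by rewrite divr_gt0.
have step1 c : (forall i, normc (c i) <= s') ->
    exists2 b, (forall m, has_sum (fun k => a k * shift_coef c k m) (b m)) &
    forall m, normc (b m) * monomial (fun=> d / 2) m <= M.
  move=> cs; have s0 : 0 < s by lra.
  have [||b ab Fb] := @expands_at_recenter F origin c s (d / 16) a s0 Fa.
  - by move=> i; have := cs i; rewrite /origin subr0 /s'; lra.
  - by move=> i; have := cs i; rewrite /origin subr0 /s'; lra.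
  exists b.
    move=> m; apply: eq_has_sum (ab m) => k; congr (_ * shift_coef _ _ _).
    by apply/funext => i; rewrite /origin subr0.
  have [|b' Fb'] := Floc c; first by move=> i; have := cs i; rewrite /s'; lra.
  have d160 : 0 < d / 16 by rewrite divr_gt0.
  rewrite (expands_at_uniq d160 d0 Fb Fb'); apply: cauchy_estimate => //; first exact: ltW.
  move=> z zd; exists (F (fun i => c i + z i)) => //.
  by apply: Fb' => i; rewrite zd; lra.
have step2 k m : normc (a k) * shift_coef (fun=> s') k m * monomial (fun=> d / 2) m <= M.
  have e0 := mono_gt0 _ m d20; have s'm := mono_gt0 _ m s'0.
  rewrite -ler_pdivlMr // -(ler_pM2r s'm).
  rewrite -mulrA shift_coef_monomial mulrA.
  have := @cauchy_estimate R n (fun k => a k * shift_coef (fun=> 1) k m) s'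
    (M / monomial (fun=> d / 2) m * monomial (fun=> s') m) (ltW s'0).
  have -> : normc (a k) * shift_coef (fun=> 1) k m = normc (a k * shift_coef (fun=> 1) k m).
    rewrite Normc.normcM normc_shift_coef; congr (_ * shift_coef _ _ _).
    by apply/funext => i; rewrite Normc.normc1.
  apply; first by rewrite mulr_ge0 ?divr_ge0 ?(ltW e0) ?(ltW s'm).
  move=> z zs; have [|b ab bM] := step1 z; first by move=> i; rewrite zs.
  exists (b m * monomial z m).
    rewrite [b m * _]mulrC.
    apply: eq_has_sum (has_sumZ (x := monomial z m) (ab m)) => j.
    by rewrite mulrCA [monomial z m * _]mulrC shift_coef_monomial mulrA.
  rewrite Normc.normcM normc_monomial; under [X in monomial X]funext do rewrite zs.
  by rewrite ler_pM2r // ler_pdivlMr.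
move=> k; have [L /fsubsetP kL] := fset_sub_box [fset k]%fset.
have {}kL : k \in box n L by apply: kL; rewrite inE.
have -> : (fun=> s + 3 * d / 16) = (fun i : 'I_n => s' + d / 4).
  by apply/funext => i; rewrite /s'; lra.
rewrite (monomial_add _ _ kL) mulr_sumr.
apply: le_trans (_ : \sum_(m <- box n L) M * monomial (fun=> 1 / 2) m <= _).
  apply: ler_sum => m _.
  have -> : (fun _ : 'I_n => d / 4) = (fun i => d / 2 * (1 / 2)).
    by apply/funext => i; lra.
  rewrite monomialM !mulrA ler_wpM2r //; first by apply: monomial_ge0 => i; lra.
rewrite -mulr_sumr ler_wpM2l //.
apply: le_trans (sum_monomial_le _ _) _; first by move=> i; lra.
rewrite prodr_const card_ord.
have -> : (1 - 1 / 2 : R)^-1 = 2 by field.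
by [].
Qed.

(** Comparison with a geometric series. *)
Lemma growth_abs_summable a (t M : R) (z : 'I_n -> R[i]) : 0 < t ->
  (forall k, normc (a k) * monomial (fun=> t) k <= M) ->
  (forall i, normc (z i) < t) ->
  abs_bound (fun k => a k * monomial z k) (M * \prod_i (1 - normc (z i) / t)^-1).
Proof.
move=> t0 aM zt A.
have M0 : 0 <= M.
  apply: le_trans (aM [ffun=> 0%N]); rewrite mulr_ge0 ?normc_ge0 //.
  by apply: monomial_ge0 => i; exact: ltW.
apply: le_trans (_ : \sum_(k <- A) M * monomial (fun i => normc (z i) / t) k <= _).
  apply: ler_sum => k _; rewrite Normc.normcM normc_monomial.
  have -> : (fun i => normc (z i)) = (fun i => t * (normc (z i) / t)).
    by apply/funext => i; rewrite mulrC divfK // gt_eqF.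
  rewrite monomialM mulrA ler_wpM2r //.
  by apply: monomial_ge0 => i; rewrite divr_ge0 ?normc_ge0 ?ltW.
rewrite -mulr_sumr ler_wpM2l // sum_monomial_le // => i.
by rewrite divr_ge0 ?normc_ge0 ?ltW //= ltr_pdivrMr // mul1r.
Qed.

(** By [coefficient_growth] the series converges on the larger polydisc, to some G.
A point z there has the form c + h with c on the ray to z, |c_i| < s and |h_i| < d,
and near c the expansions of G and of F have the same coefficients, so F z = G z. *)
Lemma expands_at_extend F (M s d : R) a : 0 < d <= s -> (forall x, normc (F x) <= M) ->
  expands_at F origin s a ->
  (forall c, (forall i, normc (c i) < s) -> exists b, expands_at F c d b) ->
  expands_at F origin (s + d / 8) a.
Proof.
move=> ds FM Fa Floc; have aM := coefficient_growth ds FM Fa Floc.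
move: ds => /andP[d0 ds].
pose G (z : 'I_n -> R[i]) : R[i]^o := xget 0 [set v | has_sum (fun k => a k * monomial z k) v].
have GE z : (forall i, normc (z i) < s + d / 8) ->
    has_sum (fun k => a k * monomial z k) (G z).
  move=> zs; have [||v hv] := abs_has_sum (growth_abs_summable (z := z) _ aM _); first lra.
    by move=> i; have := zs i; lra.
  by rewrite /G; case: xgetP => [v' _ //|/(_ v)].
have Ga : expands_at G origin (s + d / 8) a.
  move=> h hs; have -> : (fun i => origin i + h i) = h by apply/funext => i; rewrite add0r.
  exact: GE.
(* places c at radius s - d/16, and h at radius 3 d/16 < d *)
move=> z zs; pose l := (s - d / 16) / (s + d / 8).
have l0 : 0 < l by rewrite /l divr_gt0; lra.
have l1 : l < 1 by rewrite /l ltr_pdivrMr; lra.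
pose c i := l%:C * z i; pose h i := (1 - l)%:C * z i.
have nc i : normc (c i) < s - d / 16.
  rewrite /c Normc.normcM normc_real gtr0_norm // -[ltRHS](@divfK _ (s + d / 8)); last lra.
  by rewrite -/l ltr_pM2l.
have nh i : normc (h i) < d.
  rewrite /h Normc.normcM normc_real gtr0_norm ?subr_gt0 //.
  apply: (@lt_trans _ _ ((1 - l) * (s + d / 8))); first by rewrite ltr_pM2l ?subr_gt0.
  rewrite mulrBl mul1r /l divfK; lra.
have ch i : normc (c i) + normc (h i) = normc (z i).
  rewrite /c /h !Normc.normcM !normc_real !gtr0_norm ?subr_gt0 //; ring.
have zE : (fun i => c i + h i) = z.
  by apply/funext => i; rewrite /c /h -mulrDl -rmorphD /= subrKC mul1r.
have [||b [ab Gb]] := @recenter _ _ G origin (s + d / 8) a c _ Ga; first lra.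
  by move=> i; have := nc i; lra.
have [|b' Fb'] := Floc c; first by move=> i; have := nc i; lra.
have bb' : b = b'.
  have d160 : 0 < d / 16 by rewrite divr_gt0.
  apply: (expands_at_uniq d160 d0 _ Fb').
  have s0 : 0 < s by lra.
  apply: (@expands_at_shift F origin c s (d / 16) a b s0 Fa) => [i|i|m].
  - by have := nc i; rewrite /origin subr0; lra.
  - by have := nc i; rewrite /origin subr0; lra.
  - apply: eq_has_sum (ab m) => k; congr (_ * shift_coef _ _ _).
    by apply/funext => i; rewrite /origin subr0.
have FG : F z = G z.
  apply: (@has_sum_uniq _ _ (fun m => b m * monomial h m)).
    by rewrite bb' -zE; apply: Fb'.
  have -> : G z = G (fun i => origin i + (c i + h i)).
    by rewrite -[in LHS]zE; congr G; apply/funext => i; rewrite add0r.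
  by apply: Gb => i; rewrite ch.
have -> : (fun i => origin i + z i) = z by apply/funext => i; rewrite add0r.
by rewrite FG; exact: GE.
Qed.

(** The gain d/8 per step of [expands_at_extend] does not depend on the step. *)
Lemma expands_at_iter F (M rho d : R) : 0 < d <= rho -> (forall x, normc (F x) <= M) ->
  (forall c, (forall i, normc (c i) <= rho) -> exists b, expands_at F c d b) ->
  exists a, expands_at F origin rho a.
Proof.
move=> /andP[d0 dr] FM Floc.
have [|a Fa] := Floc origin; first by move=> i; rewrite Normc.normc0; lra.
exists a.
(* the minimum keeps all centres in the region where the radius d is available *)
have H j : expands_at F origin (Num.min rho (d + j%:R * (d / 8))) a.
  elim: j => [|j IH]; first by rewrite mul0r addr0; apply: expands_atW Fa; rewrite ge_min lexx orbT.
  set s := Num.min rho _ in IH *.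
  apply: expands_atW (_ : _ <= s + d / 8) _; last first.
    apply: (expands_at_extend _ FM IH).
      rewrite d0 /s le_min dr /= lerDl mulr_ge0 //; lra.
    move=> c cs; apply: Floc => i; apply: ltW; apply: lt_le_trans (cs i) _.
    by rewrite /s ge_min lexx.
  rewrite /s; set t := d + j%:R * (d / 8).
  have -> : d + j.+1%:R * (d / 8) = t + d / 8 by rewrite /t -natr1; ring.
  case: (leP rho t) => h; rewrite ge_min; apply/orP; [left|right]; lra.
have j0 : 0 <= rho / (d / 8) by apply: divr_ge0; lra.
have := archi_boundP j0; set j := Num.bound _ => hj.
apply: expands_atW (H j); rewrite le_min lexx /=.
move: hj; rewrite ltr_pdivrMr; lra.
Qed.

Lemma closed_disc_compact (rho : R) :
  compact [set p : R * R | normc (p.1 +i* p.2) <= rho].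
Proof.
have [r0|r0] := ltP rho 0.
  rewrite (_ : mkset _ = set0); first exact: compact0.
  by apply/seteqP; split => // p h; have := le_lt_trans h r0; rewrite ltNge normc_ge0.
have cI : compact (`[- rho, rho] `*` `[- rho, rho] : set (R * R)).
  by apply: compact_setX; exact: segment_compact.
apply: (subclosed_compact _ cI); last first.
  move=> [x y] /= h; have := Re_le_normc (x +i* y); have := Im_le_normc (x +i* y).
  move=> /= hy hx; have := le_trans hx h; have := le_trans hy h.
  by rewrite /= !in_itv /= !ler_norml.
rewrite (_ : mkset _ = (fun p : R * R => p.1 * p.1 + p.2 * p.2) @^-1` [set t | t <= rho ^+ 2]).
  apply: closed_comp; last exact: closed_le.
  move=> p _; apply: cvgD; apply: cvgM; by [exact: cvg_fst|exact: cvg_snd].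
apply/seteqP; split => p /=; rewrite -!expr2.
  move=> h; rewrite -[leLHS]sqr_sqrtr ?addr_ge0 ?sqr_ge0 //.
  by rewrite lerXn2r ?nnegrE ?sqrtr_ge0.
by move=> h; rewrite -[leRHS](ger0_norm r0) -sqrtr_sqr ler_wsqrtr.
Qed.

Lemma closed_cdisc_compact (rho : R) : compact [set x : R[i]^o | normc x <= rho].
Proof.
pose f (p : R * R) : R[i]^o := p.1 +i* p.2.
rewrite (_ : mkset _ = f @` [set p : R * R | normc (p.1 +i* p.2) <= rho]); last first.
  apply/seteqP; split => [[x y] h|_ [p h <-] //].
  by exists (x, y).
apply: continuous_compact (@closed_disc_compact rho).
apply: continuous_subspaceT => p; apply/cvgrPdist_lt => -[e ei].
rewrite ltcE /= => /andP[/eqP -> e0]; have e20 : 0 < e / 2 by rewrite divr_gt0.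
exists (ball p.1 (e / 2), ball p.2 (e / 2)).
  by split; exact: nbhsx_ballx.
move=> [x y] /= [h1 h2]; rewrite normrcE ltcR.
apply: le_lt_trans (normc_le_ReIm _) _; rewrite [ltRHS]splitr.
exact: ltrD h1 h2.
Qed.

(** An expansion of radius r at c can be re-centred at every c' within r/2 of c with
radius r/2; compactness turns these local radii into a common one. *)
Lemma local_radius_uniform F (rho : R) :
  (forall c, (forall i, normc (c i) <= rho) -> exists (r : R) a, 0 < r /\ expands_at F c r a) ->
  exists2 d : R, 0 < d & forall c, (forall i, normc (c i) <= rho) -> exists a, expands_at F c d a.
Proof.
move=> Floc.
pose toC (v : 'rV[R[i]^o]_n) i : R[i] := v ord0 i.
pose D := [set x : R[i]^o | normc x <= rho].
pose K := [set v : 'rV[R[i]^o]_n | forall i, D (v ord0 i)].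
have /compact_near_coveringP cK : compact K.
  by apply: (@rV_compact _ n (fun=> D)) => _; exact: closed_cdisc_compact.
have /= := cK R (0^'+) (fun d v => exists a, expands_at F (toC v) d a) _.
move=> H; have : \forall d \near 0^'+, K `<=` [set v | exists a, expands_at F (toC v) d a].
  apply: H => v Kv; have [r [a [r0 Fa]]] := Floc (toC v) Kv.
  have r20 : 0 < (r / 2)%:C by rewrite ltcR divr_gt0.
  exists (ball v (r / 2)%:C, [set d : R | d < r / 2]).
    split => /=; first exact: nbhsx_ballx.
    by apply: nbhs_right_lt; rewrite divr_gt0.
  move=> [v' d] /= [vv' dr].
  have cc i : normc (toC v' i - toC v i) <= r / 2.
    have : ball (v ord0 i) (r / 2)%:C (v' ord0 i) by have [_] := vv'; exact.
    by rewrite /ball /= normrcE ltcR normc_distC => /ltW.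
  have [||b _ Fb] := @expands_at_recenter F (toC v) (toC v') r d a r0 Fa.
  - by move=> i; have := cc i; lra.
  - by move=> i; have := cc i; lra.
  - by exists b.
move=> [e /= e0 He]; exists (e / 2); first by rewrite divr_gt0.
move=> c cr; have [] := He (e / 2) _ _ (\row_i c i).
- by rewrite /= sub0r normrN gtr0_norm ?divr_gt0 //; lra.
- by rewrite divr_gt0.
- by move=> i; rewrite mxE; exact: cr.
- move=> a; rewrite (_ : toC _ = c); first by exists a.
  by apply/funext => i; rewrite /toC mxE.
Qed.

(** Each rho < 1 gives an expansion on the polydisc of radius rho; these have the same
coefficients by uniqueness. *)
Lemma expands_at_polydisc F (M : R) : (forall x, normc (F x) <= M) ->
  (forall c, (forall i, normc (c i) < 1) -> exists (r : R) a, 0 < r /\ expands_at F c r a) ->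
  exists a, expands_at F origin 1 a.
Proof.
move=> FM Floc.
have step (rho : R) : 0 < rho < 1 -> exists a, expands_at F origin rho a.
  move=> /andP[r0 r1]; have [|d d0 Hd] := @local_radius_uniform F rho.
    by move=> c cr; apply: Floc => i; apply: le_lt_trans (cr i) r1.
  apply: (@expands_at_iter F M rho (Num.min d rho)) => //.
    by rewrite lt_min d0 r0 ge_min lexx orbT.
  move=> c /Hd [a Fa]; exists a; apply: expands_atW Fa; by rewrite ge_min lexx.
have [|a Fa] := step (1 / 2); first lra.
exists a => z z1; have [s /andP[s0 s1] zs] := strict_bound_exists ltr01 z1.
have [|b Fb] := step ((s + 1) / 2); first lra.
have h12 : 0 < 1 / 2 :> R by lra.
have hs : 0 < (s + 1) / 2 by lra.
rewrite (expands_at_uniq h12 hs Fa Fb); apply: Fb => i; have := zs i; lra.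
Qed.

End Continuation.

(** * The Hardy space as a Hilbert space *)

Lemma mul_le_sqrD (R : realFieldType) (x y : R) : x * y <= x ^+ 2 + y ^+ 2.
Proof. by nra. Qed.

(** The scalar identity behind |f - t w g|^2 with w = <f, g>. *)
Lemma real_expansion (R : rcfType) (w : R[i]) (t F G : R) :
  F%:C - (t%:C * w)^* * w - t%:C * w * (w^* - (t%:C * w)^* * G%:C) =
  (F - 2 * t * normc w ^+ 2 + t ^+ 2 * normc w ^+ 2 * G)%:C.
Proof.
case: w => a b; rewrite /normc sqr_sqrtr ?addr_ge0 ?sqr_ge0 //.
by apply/eqP; rewrite eq_complex /=; apply/andP; split; apply/eqP; ring.
Qed.

(** The choice t = 1/(G + 1) is close to the minimizer 1/G and also covers G = 0. *)
Lemma quadratic_min_le (R : realFieldType) (F G d w : R) (t := (G + 1)^-1) :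
  0 <= G -> 0 <= w -> d <= F - 2 * t * w + t ^+ 2 * w * G -> w <= (F - d) * (G + 1).
Proof.
move=> g0 w0 H; have g1 : 0 < G + 1 by lra.
have t0 : 0 < t by rewrite invr_gt0.
rewrite -ler_pdivrMr // -/t.
have E : t ^+ 2 * w * G = t * w * (t * (G + 1) - t) by ring.
rewrite E mulVf ?gt_eqF // in H; have := mulr_ge0 (mulr_ge0 (ltW t0) w0) (ltW t0).
lra.
Qed.

Section Hardy.
Variables (R : realType) (n : nat).
Implicit Types (a b : multi_index n -> R[i]^o) (f g h : H2 R n).

Definition coords (z : polydisc R n) : 'I_n -> R[i] := fun i => z ord0 i.

Lemma coords_lt1 z i : normc (coords z i) < 1.
Proof.
have /forallP/(_ i) := valP z.
by rewrite normrcE => z1; rewrite -ltcR.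
Qed.

Lemma polydisc_of (x : 'I_n -> R[i]) : (forall i, normc (x i) < 1) ->
  exists z : polydisc R n, coords z = x.
Proof.
move=> x1.
have H : [forall i, `|(\row_i x i) ord0 i| < 1].
  by apply/forallP => i; rewrite mxE normrcE -(rmorph1 (real_complex R)) ltcR.
by exists (Polydisc H); apply/funext => i; rewrite /coords /= mxE.
Qed.

Lemma power_term0 a (z : polydisc R n) :
  power_term a 0 z = fun k => a k * monomial (coords z) k.
Proof.
apply/funext => k; rewrite /power_term; congr (_ * _).
by apply: eq_bigr => i _; rewrite mxE subr0.
Qed.

Lemma expandsP (f : cfun R n) a : expands f a <->
  forall z, has_sum (fun k => a k * monomial (coords z) k) (f z).
Proof. by split => H z; have := H z; rewrite power_term0. Qed.

(** Hence the arbitrary choice in [taylor] is harmless. *)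
Lemma expands_uniq (f : cfun R n) a b : expands f a -> expands f b -> a = b.
Proof.
move=> /expandsP fa /expandsP fb; apply: (@power_series_uniq R n _ _ 1) => // h h1.
have [z <-] := polydisc_of h1; by exists (f z).
Qed.

Definition l2 a := exists B : R, forall A : {fset multi_index n},
  \sum_(k <- A) normc (a k) ^+ 2 <= B.

Lemma square_summableP a : square_summable a <-> l2 a.
Proof.
have u0 k : (0 <= (normc (a k) ^+ 2)%:E)%E by rewrite lee_fin sqr_ge0.
rewrite /square_summable; split => [|[B HB]].
  move=> sy; have s0 : (0 <= \esum_(k in [set: multi_index n]) (normc (a k) ^+ 2)%:E)%E.
    exact: esum_ge0.
  exists (fine (\esum_(k in [set: multi_index n]) (normc (a k) ^+ 2)%:E)) => A.
  rewrite -lee_fin fineK ?ge0_fin_numE // -sumEFin.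
  apply: esum_ge; exists [set` A]; first by split.
  by rewrite fsbig_finite //= set_fsetK.
apply: le_lt_trans (ltry B); apply: ge_ereal_sup => _ [X [finX _] <-].
by rewrite fsbig_finite // sumEFin lee_fin.
Qed.

Lemma l2ZD (x : R[i]) a b : l2 a -> l2 b -> l2 (fun k => x * a k + b k).
Proof.
move=> [A HA] [B HB]; exists (2 * normc x ^+ 2 * A + 2 * B) => C.
apply: le_trans (ler_sum _ (fun k _ => normc_sqrZD x (a k) (b k))) _.
rewrite big_split /= -!mulr_sumr; apply: lerD; apply: ler_wpM2l => //.
by rewrite mulr_ge0 ?sqr_ge0.
Qed.

Lemma l2_bounded a : l2 a -> exists B : R, forall k, normc (a k) <= B.
Proof.
move=> [B HB]; exists (B + 1) => k; have := HB [fset k]%fset; rewrite big_seq_fset1.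
have := sqr_ge0 (normc (a k) - 1); rewrite sqrrB1; have := normc_ge0 (a k).
rewrite mulr2n; lra.
Qed.

Lemma l2_expands a : l2 a -> exists f : cfun R n, expands f a.
Proof.
move=> /l2_bounded[B HB].
have /choice[f fa] (z : polydisc R n) :
    exists v : R[i]^o, has_sum (fun k => a k * monomial (coords z) k) v.
  apply: abs_has_sum; apply: (@growth_abs_summable R n a 1 B) => // [k|i].
    by rewrite monomial1 mulr1.
  exact: coords_lt1.
by exists f; apply/expandsP.
Qed.

(** The coefficients chosen by [taylor] are the square summable ones by uniqueness. *)
Lemma hardy2_taylor f : expands f (taylor f) /\ l2 (taylor f).
Proof.
have [a fa /square_summableP al] : hardy2 f by have /asboolP := valP f.
rewrite /taylor; case: xgetP => [b _ fb|/(_ a)//].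
by have -> : b = a by exact: expands_uniq fb fa.
Qed.

Lemma taylorP f : expands f (taylor f). Proof. exact: (hardy2_taylor f).1. Qed.
Lemma taylor_l2 f : l2 (taylor f). Proof. exact: (hardy2_taylor f).2. Qed.

Lemma taylorE f a : expands f a -> taylor f = a.
Proof. exact: expands_uniq (@taylorP f). Qed.

Lemma H2_of_fun (F : cfun R n) a : expands F a -> l2 a -> exists2 f : H2 R n, f =1 F & taylor f = a.
Proof.
move=> Fa al; have hF : F \in @hardy2_pred R n.
  by apply/asboolP; exists a => //; exact/square_summableP.
by exists (MkH2 hF) => //; exact: taylorE.
Qed.

Lemma H2_of_l2 a : l2 a -> exists f : H2 R n, taylor f = a.
Proof. by move=> al; have [F Fa] := l2_expands al; have [f] := H2_of_fun Fa al; exists f. Qed.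

Lemma H2_ext f g : f =1 g -> f = g.
Proof. by move=> fg; apply: val_inj; apply/funext. Qed.

Lemma taylor_inj f g : taylor f = taylor g -> f = g.
Proof.
move=> fg; apply: H2_ext => z; have := @taylorP f z; rewrite fg => h.
exact: has_sum_uniq h (@taylorP g z).
Qed.

Lemma taylorZD (x : R[i]) f g : taylor (x *: f + g) = fun k => x * taylor f k + taylor g k.
Proof.
apply: taylorE; apply/expandsP => z.
have /expandsP/(_ z) hf := @taylorP f; have /expandsP/(_ z) hg := @taylorP g.
apply: eq_has_sum (has_sumZD (x := x) hf hg) => k.
by rewrite mulrDl -mulrA.
Qed.

Lemma taylorB f g : taylor (f - g) = fun k => taylor f k - taylor g k.
Proof.
have -> : f - g = (-1) *: g + f by rewrite scaleN1r addrC.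
by rewrite taylorZD; apply/funext => k; rewrite mulN1r addrC.
Qed.

Lemma h2dot_has_sum f g :
  has_sum (fun k => taylor f k * (taylor g k)^* : R[i]^o) (h2dot f g).
Proof.
have [A HA] := taylor_l2 f; have [B HB] := taylor_l2 g.
have [|s us] := @abs_has_sum R n (fun k => taylor f k * (taylor g k)^*) (A + B).
  move=> C; apply: le_trans (lerD (HA C) (HB C)); rewrite -big_split /=.
  apply: ler_sum => k _; rewrite Normc.normcM normc_conj.
  exact: mul_le_sqrD.
rewrite /h2dot /summability.sum.
rewrite (_ : lim _ = s) //.
apply: cvg_lim us; exact: norm_hausdorff.
Qed.

Lemma h2dotZD (x : R[i]) f g h : h2dot (x *: f + g) h = x * h2dot f h + h2dot g h.
Proof.
apply: (has_sum_uniq (@h2dot_has_sum _ _)).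
apply: eq_has_sum (has_sumZD (x := x) (@h2dot_has_sum f h) (@h2dot_has_sum g h)) => k.
by rewrite taylorZD mulrDl -mulrA.
Qed.

Lemma h2dot_conj f g : h2dot g f = (h2dot f g)^*.
Proof.
apply: (has_sum_uniq (@h2dot_has_sum _ _)).
apply: eq_has_sum (has_sum_conj (@h2dot_has_sum f g)) => k.
rewrite rmorphM mulrC; congr (_ * _); exact: conjcK.
Qed.

Lemma h2dot0l h : h2dot 0 h = 0.
Proof. by have := h2dotZD (-1) h h h; rewrite scaleN1r addNr mulN1r addNr. Qed.

Lemma h2dotZl x f h : h2dot (x *: f) h = x * h2dot f h.
Proof. by have := h2dotZD x f 0 h; rewrite addr0 h2dot0l addr0. Qed.

Lemma h2dotDl f g h : h2dot (f + g) h = h2dot f h + h2dot g h.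
Proof. by have := h2dotZD 1 f g h; rewrite scale1r mul1r. Qed.

Lemma h2dotBl f g h : h2dot (f - g) h = h2dot f h - h2dot g h.
Proof. by rewrite -scaleN1r addrC h2dotZD mulN1r addrC. Qed.

Lemma h2dotBr f g h : h2dot f (g - h) = h2dot f g - h2dot f h.
Proof.
rewrite (h2dot_conj (g - h) f) (h2dotBl g h f) (h2dot_conj g f) (h2dot_conj h f).
exact: (rmorphB (@conjc R)).
Qed.

Lemma h2dotDr f g h : h2dot f (g + h) = h2dot f g + h2dot f h.
Proof.
rewrite (h2dot_conj (g + h) f) (h2dotDl g h f) (h2dot_conj g f) (h2dot_conj h f).
exact: (rmorphD (@conjc R)).
Qed.

Lemma h2dotZr x f h : h2dot f (x *: h) = x^* * h2dot f h.
Proof.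
rewrite (h2dot_conj (x *: h) f) (h2dotZl x h f) (h2dot_conj h f).
exact: (rmorphM (@conjc R)).
Qed.

Lemma h2dot0r h : h2dot h 0 = 0.
Proof. by rewrite (h2dot_conj 0 h) h2dot0l; exact: conjc0. Qed.

Lemma h2dot_eq0_sym f g : h2dot f g = 0 -> h2dot g f = 0.
Proof. by rewrite (h2dot_conj f g) => ->; exact: conjc0. Qed.

(** The squared norm.  Taking the modulus of <f, f> makes it nonnegative by
construction; [h2dot_ff] shows that nothing is lost. *)
Definition sqnorm f : R := normc (h2dot f f).

Lemma sqnorm0 : sqnorm 0 = 0.
Proof. by rewrite /sqnorm h2dot0l; exact: Normc.normc0. Qed.

Lemma h2dot_sqnorm_has_sum f :
  has_sum (fun k => (normc (taylor f k) ^+ 2)%:C : R[i]^o) (h2dot f f).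
Proof. by apply: eq_has_sum (@h2dot_has_sum f f) => k; rewrite normc_sqrE. Qed.

Lemma partial_sum_le_h2dot f (A : {fset multi_index n}) :
  \sum_(k <- A) normc (taylor f k) ^+ 2 <= complex.Re (h2dot f f).
Proof.
apply/ler_addgt0Pr => e e0.
have /has_sumP/(_ e e0)[A0 HA] := @h2dot_sqnorm_has_sum f.
apply: le_trans (big_fset_sub_le _ (fsubsetUr A0 A)) _; first by move=> k; rewrite sqr_ge0.
have := HA _ (fsubsetUl A0 A); rewrite -rmorph_sum /=.
move=> /(le_lt_trans (Re_le_normc _)).
case: (h2dot f f) => x y /=; rewrite ltr_norml => /andP[]; lra.
Qed.

Lemma h2dot_ff f : h2dot f f = (sqnorm f)%:C.
Proof.
have r0 := partial_sum_le_h2dot f fset0; rewrite big_nil in r0.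
have : h2dot f f = (h2dot f f)^* by exact: h2dot_conj.
rewrite /sqnorm; case: (h2dot f f) r0 => x y /= x0 [] yy.
have -> : y = 0 by lra.
by rewrite expr0n addr0 sqrtr_sqr ger0_norm.
Qed.

Lemma sqnorm_ge0 f : 0 <= sqnorm f. Proof. exact: normc_ge0. Qed.

Lemma le_sqnorm f (A : {fset multi_index n}) : \sum_(k <- A) normc (taylor f k) ^+ 2 <= sqnorm f.
Proof. by have := partial_sum_le_h2dot f A; rewrite h2dot_ff. Qed.

Lemma sqnorm_le f (B : R) :
  (forall A : {fset multi_index n}, \sum_(k <- A) normc (taylor f k) ^+ 2 <= B) -> sqnorm f <= B.
Proof.
move=> HB; apply: has_sum_le (@h2dot_sqnorm_has_sum f) => A.
under eq_bigr do rewrite normc_real ger0_norm ?sqr_ge0 //; exact: HB.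
Qed.

Lemma h2dot_ff_eq0 f : h2dot f f = 0 -> f = 0.
Proof.
move=> f0; have s0 : sqnorm f = 0 by rewrite /sqnorm f0 Normc.normc0.
apply: taylor_inj; apply/funext => k.
have H g : sqnorm g = 0 -> taylor g k = 0.
  move=> g0; have := le_sqnorm g [fset k]%fset; rewrite big_seq_fset1 g0 => h.
  apply: Normc.eq0_normc; apply/eqP; rewrite -sqrf_eq0 eq_le h sqr_ge0 //.
by rewrite (H f s0) (H 0 sqnorm0).
Qed.

Lemma sqnorm_sub_scale f g (t : R) : sqnorm (f - (t%:C * h2dot f g) *: g) =
  sqnorm f - 2 * t * normc (h2dot f g) ^+ 2 + t ^+ 2 * normc (h2dot f g) ^+ 2 * sqnorm g.
Proof.
set w := h2dot f g; set x : R[i] := t%:C * w.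
have E : h2dot (f - x *: g) (f - x *: g) =
    h2dot f f - x^* * w - x * (w^* - x^* * h2dot g g).
  rewrite (h2dotBl f (x *: g)) (h2dotBr f f) (h2dotZr x f g) (h2dotZl x g).
  by rewrite (h2dotBr g f) (h2dotZr x g g) (h2dot_conj f g).
apply: complexI; rewrite -h2dot_ff E !h2dot_ff.
exact: real_expansion.
Qed.

(** If the squared norm of f is close to its infimum over f + C g, then f is almost
orthogonal to g.  With d = 0 this is a form of the Cauchy-Schwarz inequality; with d
the squared distance to a subspace it shows that minimizing sequences become
orthogonal to that subspace. *)
Lemma almost_orth f g (d : R) : (forall x : R[i], d <= sqnorm (f - x *: g)) ->
  normc (h2dot f g) ^+ 2 <= (sqnorm f - d) * (sqnorm g + 1).
Proof.
move=> H; apply: quadratic_min_le (sqnorm_ge0 g) (sqr_ge0 _) _.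
by rewrite -sqnorm_sub_scale.
Qed.

Lemma cauchy_schwarz f g : normc (h2dot f g) ^+ 2 <= sqnorm f * (sqnorm g + 1).
Proof. by rewrite -[sqnorm f]subr0; apply: almost_orth => x; exact: sqnorm_ge0. Qed.

Lemma parallelogram f g : sqnorm (f - g) + sqnorm (f + g) = 2 * sqnorm f + 2 * sqnorm g.
Proof.
have E : h2dot (f - g) (f - g) + h2dot (f + g) (f + g) =
    (h2dot f f + h2dot f f) + (h2dot g g + h2dot g g).
  rewrite (h2dotBl f g) (h2dotBr f f g) (h2dotBr g f g).
  rewrite (h2dotDl f g) (h2dotDr f f g) (h2dotDr g f g).
  by move: (h2dot f f) (h2dot f g) (h2dot g f) (h2dot g g) => A B C D; ring.
rewrite !h2dot_ff in E; move: E.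
move: (sqnorm (f - g)) (sqnorm (f + g)) (sqnorm f) (sqnorm g) => A B C D E.
have := congr1 (@complex.Re R) E => /=; lra.
Qed.

Lemma real_cauchy_lim (x : nat -> R) :
  (forall e, 0 < e -> exists N, forall p q, (N <= p)%N -> (N <= q)%N -> `|x p - x q| <= e) ->
  exists l, forall e, 0 < e -> exists N, forall p, (N <= p)%N -> `|x p - l| <= e.
Proof.
move=> H; have /cauchy_cvgP/cvg_ex[l xl] : cauchy (x @ \oo).
  apply/cauchy_exP => e e0; have e20 : 0 < e / 2 by rewrite divr_gt0.
  have [N HN] := H _ e20.
  exists (x N); exists N => // p /= Np; rewrite /ball /=.
  by apply: le_lt_trans (HN _ _ (leqnn _) Np) _; lra.
exists l => e e0; have /cvgrPdist_le/(_ e e0)[N _ HN] := xl.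
by exists N => p /HN /=; rewrite distrC.
Qed.

Lemma complex_cauchy_lim (x : nat -> R[i]) :
  (forall e : R, 0 < e -> exists N, forall p q, (N <= p)%N -> (N <= q)%N -> normc (x p - x q) <= e) ->
  exists l, forall e : R, 0 < e -> exists N, forall p, (N <= p)%N -> normc (x p - l) <= e.
Proof.
move=> H.
have [|l1 H1] := @real_cauchy_lim (fun p => complex.Re (x p)).
  move=> e /H[N HN]; exists N => p q Np Nq; apply: le_trans (HN p q Np Nq).
  by apply: le_trans (Re_le_normc _); case: (x p) (x q) => ? ? [].
have [|l2 H2] := @real_cauchy_lim (fun p => complex.Im (x p)).
  move=> e /H[N HN]; exists N => p q Np Nq; apply: le_trans (HN p q Np Nq).
  by apply: le_trans (Im_le_normc _); case: (x p) (x q) => ? ? [].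
exists (l1 +i* l2) => e e0; have e20 : 0 < e / 2 by rewrite divr_gt0.
have [N1 {}H1] := H1 _ e20; have [N2 {}H2] := H2 _ e20.
exists (maxn N1 N2) => p; rewrite geq_max => /andP[/H1 h1 /H2 h2].
apply: le_trans (normc_le_ReIm _) _; rewrite [leRHS]splitr.
by case: (x p) h1 h2 => ? ? /= h1 h2; exact: lerD.
Qed.

(** The coefficients converge one by one, and Fatou's argument over finite sets of
indices gives convergence in norm. *)
Lemma H2_complete (u : nat -> H2 R n) :
  (forall e : R, 0 < e -> exists N, forall p q, (N <= p)%N -> (N <= q)%N -> sqnorm (u p - u q) <= e) ->
  exists l, forall e : R, 0 < e -> exists N, forall p, (N <= p)%N -> sqnorm (u p - l) <= e.
Proof.
move=> uC.
have /choice[a ua] k : exists l : R[i]^o, forall e : R, 0 < e -> exists N, forall p, (N <= p)%N ->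
    normc (taylor (u p) k - l) <= e.
  apply: complex_cauchy_lim => e e0; have [N HN] := uC (e ^+ 2) (exprn_gt0 2 e0).
  exists N => p q Np Nq; have := le_trans (le_sqnorm (u p - u q) [fset k]%fset) (HN p q Np Nq).
  by rewrite big_seq_fset1 taylorB ler_sqr ?nnegrE ?normc_ge0 // ltW.
have main e : 0 < e -> exists N, forall p, (N <= p)%N -> forall A : {fset multi_index n},
    \sum_(k <- A) normc (taylor (u p) k - a k) ^+ 2 <= 4 * e.
  move=> e0; have [N HN] := uC e e0; exists N => p Np A.
  have [q Nq Hq] : exists2 q, (N <= q)%N &
      \sum_(k <- A) normc (taylor (u q) k - a k) ^+ 2 <= e.
    have c0 : 0 < e / (#|` A|%:R + 1) by rewrite divr_gt0 // ltr_wpDl.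
    have [q Nq Hq] : exists2 q, (N <= q)%N & forall k, k \in A ->
        normc (taylor (u q) k - a k) ^+ 2 <= e / (#|` A|%:R + 1).
      pose c := Num.sqrt (e / (#|` A|%:R + 1)).
      have c00 : 0 < c by rewrite sqrtr_gt0.
      have /choice[m Hm] k := ua k c c00.
      exists (N + \sum_(k <- A) m k)%N; first exact: leq_addr.
      move=> k kA; rewrite -[leRHS]sqr_sqrtr ?(ltW c0) //.
      rewrite ler_sqr ?nnegrE ?normc_ge0 ?sqrtr_ge0 //; apply: Hm.
      by rewrite (big_rem k) //= addnCA leq_addr.
    exists q => //; apply: le_trans (_ : \sum_(k <- A) (e / (#|` A|%:R + 1)) <= _).
      by rewrite big_seq [leRHS]big_seq; apply: ler_sum => k /Hq.
    rewrite big_const_seq count_predT iter_addr addr0 -[X in X <= _]mulr_natl mulrA ler_pdivrMr; last by rewrite ltr_wpDl.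
    by rewrite mulrC ler_wpM2l ?(ltW e0) // lerDl.
  have := le_trans (le_sqnorm (u p - u q) A) (HN p q Np Nq); rewrite taylorB => Hpq.
  apply: le_trans (_ : \sum_(k <- A) (2 * normc (taylor (u p) k - taylor (u q) k) ^+ 2 +
    2 * normc (taylor (u q) k - a k) ^+ 2) <= _); last first.
    by rewrite big_split /= -!mulr_sumr; lra.
  apply: ler_sum => k _.
  have := normc_sqrZD 1 (taylor (u p) k - taylor (u q) k) (taylor (u q) k - a k).
  by rewrite mul1r addrA subrK Normc.normc1 expr1n mulr1.
have [N0 /(_ N0 (leqnn _)) H0] := main 1 ltr01.
have [|l la] := @H2_of_l2 a.
  (* the limit coefficients differ from those of some u N0 by a square summable family *)
  have h1 : l2 (fun k => taylor (u N0) k - a k) by exists (4 * 1).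
  have := l2ZD (-1) h1 (taylor_l2 (u N0)).
  by congr l2; apply/funext => k; rewrite mulN1r opprB subrK.
exists l => e e0; have e40 : 0 < e / 4 by rewrite divr_gt0.
have [N HN] := main _ e40.
exists N => p Np; apply: sqnorm_le => A; rewrite taylorB la.
by apply: le_trans (HN p Np A) _; lra.
Qed.

End Hardy.

(** * Projections, multipliers and model spaces *)

(** A minimizing sequence is Cauchy: by the parallelogram law the squared distance x
of two of its terms is controlled by the squared distance m of f to their midpoint,
which is at least the infimum d. *)
Lemma midpoint_bound (R : realFieldType) (x m a b d e p q : R) :
  x + 2 ^+ 2 * m = 2 * a + 2 * b -> d <= m -> a <= d + p -> b <= d + q ->
  p <= e / 4 -> q <= e / 4 -> x <= e.
Proof. rewrite expr2; lra. Qed.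

Lemma orth_bound (R : realFieldType) (a b F d L K e p : R) : 0 < K ->
  a <= (F - d) * K -> b <= L * K -> F <= d + p -> p <= e -> L <= e ->
  2 * a + 2 * b <= e * (4 * K).
Proof.
move=> K0 aF bL Fd pe Le; have Fe : F - d <= e by lra.
have := ler_wpM2r (ltW K0) Fe; have := ler_wpM2r (ltW K0) Le; lra.
Qed.

Section Projection.
Variables (R : realType) (n : nat).
Implicit Types (f g h : H2 R n) (M S : set (H2 R n)).

Lemma normc_sqr_eq0 (w : R[i]) (K : R) : (forall e : R, 0 < e -> normc w ^+ 2 <= e * K) -> w = 0.
Proof.
move=> H; apply: Normc.eq0_normc; apply/eqP; rewrite -sqrf_eq0 eq_le sqr_ge0 andbT.
apply/ler_addgt0Pr => e e0; rewrite add0r.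
have K0 : 0 < `|K| + 1 by rewrite ltr_wpDl.
apply: le_trans (H (e / (`|K| + 1)) (divr_gt0 e0 K0)) _.
rewrite mulrAC ler_pdivrMr // ler_pM2l //.
by apply: le_trans (ler_norm K) _; rewrite lerDl.
Qed.

Lemma inv_succ_le (e : R) : 0 < e -> exists N, forall p, (N <= p)%N -> p.+1%:R^-1 <= e.
Proof.
move=> e0; have := archi_boundP (ltW (etrans (invr_gt0 e) e0)).
set N := Num.bound _ => hN; exists N => p Np.
rewrite -[e]invrK lef_pV2 ?posrE ?invr_gt0 ?ltr0n //; apply: ltW; apply: lt_le_trans hN _.
by rewrite ler_nat leqW.
Qed.

Lemma sqnormZ (x : R[i]) f : sqnorm (x *: f) = normc x ^+ 2 * sqnorm f.
Proof. by rewrite /sqnorm h2dotZl h2dotZr !Normc.normcM normc_conj mulrA expr2. Qed.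

Local Opaque h2dot sqnorm taylor.

Lemma orthocompZD M (x : R[i]) f g : orthocomp M f -> orthocomp M g -> orthocomp M (x *: f + g).
Proof. by move=> fM gM m Mm; rewrite h2dotZD fM // gM // mulr0 addr0. Qed.

Lemma orthocompZ M (x : R[i]) f : orthocomp M f -> orthocomp M (x *: f).
Proof. by move=> fM m Mm; rewrite h2dotZl fM // mulr0. Qed.

Lemma orthocomp0 M : orthocomp M 0.
Proof. by move=> m _; exact: h2dot0l. Qed.

(** A minimizing sequence for the distance from f to the orthogonal complement of M
converges, and its limit inherits orthogonality to M and, through [almost_orth], the
orthogonality of the residue. *)
Lemma projection_exists M f :
  exists g, orthocomp M g /\ orthocomp (orthocomp M) (f - g).
Proof.
pose S := orthocomp M; pose E := [set sqnorm (f - g) | g in S].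
have Elb : has_lbound E by exists 0 => _ [g _ <-]; exact: sqnorm_ge0.
have infE : has_inf E by split => //; exists (sqnorm (f - 0)), 0 => //; exact: orthocomp0.
pose d := inf E.
have dmin g : S g -> d <= sqnorm (f - g) by move=> Sg; apply: ge_inf => //; exists g.
have /choice[u Hu] (j : nat) : exists g, S g /\ sqnorm (f - g) <= d + j.+1%:R^-1.
  have j0 : 0 < j.+1%:R^-1 :> R by rewrite invr_gt0 ltr0n.
  by have [_ [g Sg <-] h] := inf_adherent j0 infE; exists g; split => //; exact: ltW.
have SB x g h : S g -> S h -> S (x *: g + h) by exact: orthocompZD.
have [|l ul] := @H2_complete R n u.
  move=> e e0; have e40 : 0 < e / 4 by rewrite divr_gt0.
  have [N HN] := inv_succ_le e40.
  exists N => p q /HN hp /HN hq.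
  pose mid := (2^-1 : R[i]) *: (u p + u q).
  have P := parallelogram (f - u q) (f - u p).
  have E1 : f - u q - (f - u p) = u p - u q by rewrite opprB addrC addrA subrK.
  have E2 : f - u q + (f - u p) = 2 *: (f - mid).
    rewrite /mid scalerBr scalerA divff ?pnatr_eq0 // scale1r scaler_nat mulr2n.
    by rewrite addrACA -opprD [u q + _]addrC.
  have N2 : normc (2 : R[i]) = 2.
    by rewrite -(rmorph_nat (real_complex R)) normc_real ger0_norm.
  rewrite E1 E2 sqnormZ N2 in P.
  have [Sp hp'] := Hu p; have [Sq hq'] := Hu q.
  have Sm : S mid.
    rewrite /mid scalerDr; exact: (SB _ _ _ Sp (@orthocompZ M 2^-1 _ Sq)).
  exact: (midpoint_bound P (dmin _ Sm) hq' hp' hq hp).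
exists l; split.
  move=> m Mm; apply: (@normc_sqr_eq0 _ (sqnorm m + 1)) => e /ul[N /(_ N (leqnn _)) HN].
  have := cauchy_schwarz (u N - l) m; rewrite h2dotBl ((Hu N).1 m Mm) sub0r normcN.
  move=> /le_trans; apply; rewrite ler_wpM2r // addr_ge0 ?sqnorm_ge0 //.
move=> s Ss; apply: (@normc_sqr_eq0 _ (4 * (sqnorm s + 1))) => e e0.
have [N1 H1] := ul e e0; have [N2 H2] := inv_succ_le e0.
pose p := maxn N1 N2; have {}H1 := H1 p (leq_maxl _ _); have {}H2 := H2 p (leq_maxr _ _).
have [Sp hp] := Hu p.
have K0 : 0 < sqnorm s + 1 := ltr_wpDl (sqnorm_ge0 s) ltr01.
have h1 := cauchy_schwarz (u p - l) s.
have h2 : normc (h2dot (f - u p) s) ^+ 2 <= (sqnorm (f - u p) - d) * (sqnorm s + 1).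
  apply: almost_orth => x.
  (* u p + x s competes with u p in the minimization *)
  have -> : f - u p - x *: s = f - (x *: s + u p).
    by rewrite opprD (addrC (- (x *: s))) addrA.
  exact: (dmin _ (SB _ _ _ Ss Sp)).
have Efl : f - l = (f - u p) + (u p - l) by rewrite addrA subrK.
rewrite Efl h2dotDl.
have := normc_sqrZD 1 (h2dot (f - u p) s) (h2dot (u p - l) s).
rewrite mul1r Normc.normc1 expr1n mulr1 => /le_trans; apply.
exact: (orth_bound K0 h2 h1 hp H2 H1).
Qed.

Lemma orthprojP M f : orthocomp M (orthproj (orthocomp M) f) /\
  orthocomp (orthocomp M) (f - orthproj (orthocomp M) f).
Proof.
have [g Hg] := projection_exists M f.
exact: (@xgetPex _ 0 [set p | orthocomp M p /\ orthocomp (orthocomp M) (f - p)]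
  (ex_intro _ g Hg)).
Qed.

Lemma orthproj_eq M f g : orthocomp M g -> orthocomp (orthocomp M) (f - g) ->
  orthproj (orthocomp M) f = g.
Proof.
move=> Mg fg; have [Mp fp] := orthprojP M f; set p := orthproj _ _ in Mp fp *.
apply/eqP; rewrite -subr_eq0; apply/eqP/h2dot_ff_eq0.
have Mpg : orthocomp M (p - g).
  by move=> m Mm; rewrite h2dotBl (Mp m Mm) (Mg m Mm) subrr.
have pg : p - g = (f - g) - (f - p) by rewrite opprB [RHS]addrC addrA subrK.
have fgp := fg _ Mpg; have fpp := fp _ Mpg.
by rewrite {1}pg h2dotBl fgp fpp subrr.
Qed.

Lemma orthproj_selfadjoint M f g :
  h2dot (orthproj (orthocomp M) f) g = h2dot f (orthproj (orthocomp M) g).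
Proof.
have [Mf f'] := orthprojP M f; have [Mg g'] := orthprojP M g.
set p := orthproj _ f in Mf f' *; set q := orthproj _ g in Mg g' *.
transitivity (h2dot p q).
  by apply/eqP; rewrite -subr_eq0 -h2dotBr; apply/eqP/h2dot_eq0_sym/g'.
by apply/esym/eqP; rewrite -subr_eq0 -h2dotBl; apply/eqP/f'.
Qed.

Lemma orthproj0 M f : M f -> orthproj (orthocomp M) f = 0.
Proof.
move=> Mf; apply: orthproj_eq; first exact: orthocomp0.
by rewrite subr0 => g Mg; apply: h2dot_eq0_sym; exact: Mg.
Qed.

Lemma orthproj_id M f : orthocomp M f -> orthproj (orthocomp M) f = f.
Proof.
move=> Mf; apply: (orthproj_eq Mf); rewrite subrr => g _; exact: h2dot0l.
Qed.

(** The residue of the projection onto the complement of M' is orthogonal to the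
smaller complement of M. *)
Lemma orthproj_sub M M' f : M' `<=` M ->
  orthproj (orthocomp M) (orthproj (orthocomp M') f) = orthproj (orthocomp M) f.
Proof.
move=> sM; have [Mf f'] := orthprojP M f; have [Mg g'] := orthprojP M' f.
have qp : orthproj (orthocomp M') f - orthproj (orthocomp M) f =
    (f - orthproj (orthocomp M) f) - (f - orthproj (orthocomp M') f).
  by rewrite opprB [RHS]addrC addrA subrK.
apply: (orthproj_eq Mf) => s Ms.
have Ms' : orthocomp M' s by move=> m /sM; exact: Ms.
by rewrite qp h2dotBl (f' s Ms) (g' s Ms') subrr.
Qed.

End Projection.

Section CauchyProduct.
Variables (R : realType) (n : nat).
Implicit Types (a b e u : multi_index n -> R[i]^o) (i j k : multi_index n) (A : {fset multi_index n}).

Definition index_le i k := [forall l, (i l <= k l)%N].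
Definition index_add i k : multi_index n := [ffun l => (i l + k l)%N].
Definition index_sub k i : multi_index n := [ffun l => (k l - i l)%N].

Lemma index_subK i k : index_le i k -> index_add i (index_sub k i) = k.
Proof. by move/forallP => ik; apply/ffunP => l; rewrite !ffunE subnKC. Qed.

Lemma index_addK i k : index_sub (index_add i k) i = k.
Proof. by apply/ffunP => l; rewrite !ffunE addKn. Qed.

Lemma index_le_add i k : index_le i (index_add i k).
Proof. by apply/forallP => l; rewrite ffunE leq_addr. Qed.

Definition unshift i (A : {fset multi_index n}) : {fset multi_index n} :=
  [fset index_sub k i | k in [fset k in A | index_le i k]]%fset.

Lemma in_unshift i A k : (k \in unshift i A) = (index_add i k \in A).
Proof.
apply/imfsetP/idP => [[k' /=]|kA].
  by rewrite !inE /= => /andP[k'A ik'] ->; rewrite index_subK.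
by exists (index_add i k); rewrite /= ?index_addK // !inE /= kA index_le_add.
Qed.

Lemma sum_unshift (V : nmodType) i A (v : multi_index n -> V) :
  \sum_(k <- A) (if index_le i k then v (index_sub k i) else 0) = \sum_(k <- unshift i A) v k.
Proof.
rewrite /unshift big_imfset /=; last first.
  move=> k k'; rewrite !inE /= => /andP[_ ik] /andP[_ ik'] kk'.
  by rewrite -(index_subK ik) kk' index_subK.
rewrite [RHS]big_fset /= -big_mkcond /=; exact: eq_bigl.
Qed.

Lemma has_sum_shift i u (s : R[i]^o) : has_sum u s ->
  has_sum (fun k => if index_le i k then u (index_sub k i) else 0) s.
Proof.
move=> /has_sumP us; apply/has_sumP => d /us[A0 HA].
exists (index_add i @` A0)%fset => A sA; rewrite sum_unshift; apply: HA.
apply/fsubsetP => k kA; rewrite in_unshift; apply: (fsubsetP sA).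
exact: in_imfset.
Qed.

(** The sum ranges over a box that contains every i <= k. *)
Definition cauchy_product e a k : R[i]^o :=
  \sum_(i <- box n (\sum_l k l).+1) (if index_le i k then e i * a (index_sub k i) else 0).

(** [fubini] for the family e_i a_(k-i) z^k: summing over k gives e_i z^i G z, and
summing over i is a finite sum. *)
Lemma expands_mul (F G : cfun R n) e a : expands F e -> expands G a ->
  expands (fun z => F z * G z) (cauchy_product e a).
Proof.
move=> /expandsP Fe /expandsP Ga; apply/expandsP => z.
pose x := coords z.
pose E k := e k * monomial x k; pose A k := a k * monomial x k.
pose w i k : R[i]^o := E i * (if index_le i k then A (index_sub k i) else 0).
have [B1 EB] := has_sum_abs (Fe z); have [B2 AB] := has_sum_abs (Ga z).
have B20 := abs_bound_ge0 AB.
apply: (@fubini _ _ w (fun i => E i * G z) _ _ (B1 * B2)).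
- move=> H K; apply: le_trans (_ : \sum_(i <- H) normc (E i) * B2 <= _).
    apply: ler_sum => i _; under eq_bigr do rewrite Normc.normcM.
    rewrite -mulr_sumr ler_wpM2l ?normc_ge0 //.
    apply: le_trans (AB (unshift i K)); rewrite -sum_unshift.
    by apply: ler_sum => k _; case: ifP => _ //; rewrite Normc.normc0.
  by rewrite -mulr_suml ler_wpM2r.
- by move=> i; apply: has_sumZ; apply: has_sum_shift; exact: Ga.
- move=> k.
  have -> : cauchy_product e a k * monomial x k = \sum_(i <- box n (\sum_l k l).+1) w i k.
    rewrite mulr_suml; apply: eq_bigr => i _; rewrite /w /E /A.
    case: ifP => ik; last by rewrite mul0r mulr0.
    by rewrite -[in monomial x k](index_subK ik) monomialD mulrACA.
  apply: has_sum_fin => i; rewrite in_box negb_forall => ik.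
  have [l il] := existsP ik; rewrite -leqNgt in il.
  rewrite /w; case: ifP => [/forallP/(_ l) h|]; last by rewrite mulr0.
  by have := leq_trans il h; rewrite ltnNge (bigD1 l) //= leq_addr.
- have := has_sumZ (x := G z) (Fe z); rewrite [G z * _]mulrC.
  by apply: eq_has_sum => k; rewrite mulrC.
Qed.

End CauchyProduct.

Section BoundedMultiplier.
Variables (R : realType) (n : nat).
Implicit Types (c e : multi_index n -> R[i]^o) (A : {fset multi_index n}).

Lemma bernoulli (y : R) m : 0 <= y <= 1 -> 1 - m%:R * y <= (1 - y) ^+ m.
Proof.
move=> /andP[y0 y1]; elim: m => [|m IH]; first by rewrite mul0r subr0 expr0.
rewrite exprS -natr1.
have : 0 <= m%:R * y * y by rewrite !mulr_ge0.
have h : 0 <= 1 - y by lra.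
have := ler_wpM2l h IH; lra.
Qed.

(** On a finite set of indices the factors s^k stay above a fixed constant once s is
close enough to 1. *)
Lemma l2_of_radial c (C : R) : (forall s, 0 < s < 1 -> forall A : {fset multi_index n},
   \sum_(k <- A) normc (c k * monomial (fun=> s%:C) k : R[i]) ^+ 2 <= C) -> @l2 R n c.
Proof.
move=> H; exists (2 * C) => A; have [L /fsubsetP AL] := fset_sub_box A.
(* with s = 1 - y, Bernoulli gives s^m >= 1/2 for the exponent m that bounds 2 |k| on A *)
pose m := (L * n * 2)%N; pose y : R := (m%:R + 1)^-1 / 2.
have m0 : 0 <= m%:R :> R by [].
have m1 : 0 < m%:R + 1 :> R by lra.
have y0 : 0 < y by rewrite divr_gt0 ?invr_gt0.
have y1 : (m%:R + 1) * y = 1 / 2 by rewrite /y mulrA divff // gt_eqF.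
have my0 : 0 <= m%:R * y by rewrite mulr_ge0 // ltW.
have y2 : y <= 1 / 2 by lra.
have my : m%:R * y <= 1 / 2 by lra.
have : 1 - m%:R * y <= (1 - y) ^+ m by apply: bernoulli; lra.
move=> hy; have := H (1 - y) _ A; rewrite mulrC => h.
suff : \sum_(k <- A) normc (c k) ^+ 2 * (1 / 2) <= C by rewrite -mulr_suml; lra.
apply: le_trans (h _); last lra.
rewrite big_seq [leRHS]big_seq; apply: ler_sum => k /AL kL.
rewrite Normc.normcM exprMn ler_wpM2l ?sqr_ge0 //.
apply: le_trans (_ : (1 - y) ^+ m <= _); first lra.
rewrite /m exprM exprM lerXn2r ?nnegrE ?normc_ge0 ?exprn_ge0 //; try lra.
rewrite normc_monomial -[n in _ ^+ n]card_ord -prodr_const.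
have y10 : 0 <= 1 - y by lra.
apply: ler_prod => i _; rewrite normc_real (ger0_norm y10) exprn_ge0 //=.
apply: ler_wiXn2l; [by []|by lra|].
by move: kL; rewrite in_box => /forallP/(_ i)/ltnW.
Qed.

(** Extending th by 0 outside the polydisc keeps it bounded, as
[expands_at_polydisc] requires. *)
Lemma Hinfty_expands (th : cfun R n) : Hinfty th ->
  exists2 e, expands th e & exists2 M : R, 0 <= M & forall z, normc (th z) <= M.
Proof.
move=> [an [M thM]].
have nM z : normc (th z) <= M by have := thM z; rewrite normrcE lecR.
have M0 : 0 <= M by apply: le_trans (nM (polydisc0 R n)); exact: normc_ge0.
pose F (x : 'I_n -> R[i]) : R[i]^o :=
  if insub (\row_i x i) is Some z then th (z : polydisc R n) else 0.
have FE z : F (coords z) = th z.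
  rewrite /F (_ : \row_i coords z i = val z); first by rewrite valK.
  by apply/rowP => i; rewrite mxE.
have [| |e Fe] := @expands_at_polydisc R n F M.
- by move=> x; rewrite /F; case: insub => [z|]; rewrite ?nM // Normc.normc0.
- move=> c c1; have [z0 zc] := polydisc_of c1.
  have [a [r [r0 Ha]]] := an z0.
  have [s /andP[s0 s1] cs] := strict_bound_exists ltr01 c1.
  exists (Num.min r (1 - s)), a; split; first by rewrite lt_min r0 subr_gt0.
  move=> h hr.
  have [|z zE] := @polydisc_of R n (fun i => c i + h i).
    move=> i; apply: le_lt_trans (le_normcD _ _) _.
    have := hr i; rewrite lt_min => /andP[_]; have := cs i; lra.
  rewrite -zE FE.
  have zh i : z ord0 i - z0 ord0 i = h i.
    rewrite -[z ord0 i]/(coords z i) -[z0 ord0 i]/(coords z0 i) zE zc; ring.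
  have := Ha z; rewrite /power_term.
  under eq_fun do under eq_bigr do rewrite zh.
  apply => i; rewrite zh normrcE ltcR; by have := hr i; rewrite lt_min => /andP[].
exists e; last by exists M.
apply/expandsP => z; rewrite -FE; have := Fe (coords z) (@coords_lt1 _ _ z).
by congr (has_sum _ (F _)); apply/funext => i; rewrite add0r.
Qed.

(** On each torus of radius s < 1 one has |th f| <= M |f|, so [parseval_le] bounds the
square sums of the rescaled coefficients of th f uniformly in s. *)
Lemma Hinfty_mul (th : cfun R n) (f : H2 R n) : Hinfty th ->
  exists g : H2 R n, forall z, g z = th z * f z.
Proof.
move=> /Hinfty_expands[e the [M M0 thM]].
have fa := @taylorP _ _ f; have [D HD] := taylor_l2 f.
have prod := expands_mul the fa; set c := cauchy_product _ _ in prod.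
suff cl : l2 c by have [g gE _] := H2_of_fun prod cl; exists g.
have D0 : 0 <= D by have := HD fset0; rewrite big_nil.
have s1 (s : R) (x : 'I_n -> R[i]) : 0 < s < 1 -> (forall i, normc (x i) = 1) ->
    exists z : polydisc R n, coords z = fun i => s%:C * x i.
  move=> /andP[s0 s1] x1; apply: polydisc_of => i.
  by rewrite Normc.normcM x1 mulr1 normc_real gtr0_norm.
apply: (@l2_of_radial c (M ^+ 2 * D)) => s s01.
have [|z0 z0E] := s1 s (fun=> 1) s01; first by move=> i; rewrite Normc.normc1.
have radius (v : multi_index n -> R[i]^o) (V : cfun R n) : expands V v ->
    exists B, abs_bound (fun k => v k * monomial (fun=> s%:C) k) B.
  move=> /expandsP/(_ z0)/has_sum_abs[B HB]; exists B.
  by move: HB; rewrite z0E; have -> : (fun=> s%:C * 1) = (fun=> s%:C : R[i]) :> ('I_n -> R[i])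
    by apply/funext => i; rewrite mulr1.
have [B1 cB] := radius _ _ prod; have [B2 fB] := radius _ _ fa.
apply: (parseval_le M0 cB fB).
  move=> x g h x1 cg fh; have [z zE] := s1 s x s01 x1.
  have E (v : multi_index n -> R[i]^o) (V : cfun R n) (t : R[i]^o) : expands V v ->
      has_sum (fun k => v k * monomial (fun=> s%:C) k * monomial x k) t -> t = V z.
    move=> /expandsP/(_ z) h1 h2; apply: has_sum_uniq h2 _; apply: eq_has_sum h1 => k.
    by rewrite zE monomialM mulrA.
  by rewrite (E _ _ _ prod cg) (E _ _ _ fa fh) Normc.normcM ler_wpM2r // normc_ge0.
move=> A; apply: le_trans (HD A); apply: ler_sum => k _.
rewrite Normc.normcM exprMn ler_piMr ?sqr_ge0 // expr_le1 ?normc_ge0 //.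
rewrite normc_monomial -(monomial1 R k); apply: ler_monomial => i.
by case/andP: s01 => s0 s1'; rewrite normc_real gtr0_norm // !ltW.
Qed.

End BoundedMultiplier.

Section Final.
Variables (R : realType) (n : nat).
Implicit Types (f g : H2 R n) (phi psi : cfun R n).

(** For an operator that has an adjoint, the choice in [adjoint] satisfies the defining
identity. *)
Lemma adjointP (T S : H2 R n -> H2 R n) : (forall f g, h2dot (T f) g = h2dot f (S g)) ->
  forall f g, h2dot (T f) g = h2dot f (adjoint T g).
Proof.
move=> TS; exact: (@xgetPex _ (fun=> 0)
  [set S | forall f g, h2dot (T f) g = h2dot f (S g)] (ex_intro _ S TS)).
Qed.

Lemma mult_range_divides phi psi : divides phi psi -> mult_range psi `<=` mult_range phi.
Proof.
move=> [th thH E] g [f gf]; have [h hE] := Hinfty_mul f thH.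
by exists h => z; rewrite gf E hE mulrA.
Qed.

Lemma gcd_divides J phi psi : is_gcd J phi -> is_gcd J psi -> divides phi psi.
Proof. by move=> [_ phi_inner phiJ _] [_ _ _ psi_max]; exact: psi_max. Qed.

(** An element of the set that is a gcd of it divides every other gcd. *)
Lemma gcd_in_ker (T : H2 R n -> H2 R n) phi : contains_gcd (inner_in_ker T) ->
  is_gcd (inner_in_ker T) phi -> mult_range phi `<=` op_ker T.
Proof.
move=> [chi [_ chi_ker] chi_gcd] phi_gcd.
apply: subset_trans chi_ker; apply: mult_range_divides; exact: gcd_divides chi_gcd phi_gcd.
Qed.

End Final.

Theorem theorem6p2 (R : realType) (n : nat) (hn : (1 <= n)%N)
    (T : {linear H2 R n -> H2 R n}) (hTbounded : bounded_operator T)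
    (hTnonzero : exists f, T f <> 0) (hgcd : gcd_property T)
    (psiT psiTadj : cfun R n)
    (hpsiT : is_gcd (inner_of T) psiT)
    (hpsiTadj : is_gcd (inner_of_adj T) psiTadj) :
  product_of_two_model_projections T <->
  (T : H2 R n -> H2 R n) = model_projection psiT \o model_projection psiTadj.
Proof.
split=> [[phi [psi [phi_inner psi_inner TE]]]|TE]; last first.
  by exists psiT, psiTadj; split; [case: hpsiT|case: hpsiTadj|].
have TEf f : T f = model_projection phi (model_projection psi f) by rewrite TE.
have [gcdT gcdTadj] := hgcd.
have adjT : forall f g, h2dot (T f) g = h2dot f (adjoint T g).
  apply: (@adjointP _ _ _ (model_projection psi \o model_projection phi)) => f g.
  by rewrite TEf /= /model_projection /model_space !orthproj_selfadjoint.
(* <f, T^* g> = <P_phi P_psi f, g> = 0 for g in phi H^2 *)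
have phiJ : inner_of T phi.
  split => // g gphi; apply: h2dot_ff_eq0; rewrite -adjT TEf.
  exact: (orthprojP (mult_range phi) _).1 _ gphi.
have psiJ : inner_of_adj T psi.
  split => // g gpsi; rewrite /op_ker /= TEf /model_projection /model_space.
  rewrite (orthproj0 gpsi); apply: orthproj_eq; first exact: orthocomp0.
  by rewrite subr0 => m _; exact: h2dot0l.
have kerT := gcd_in_ker gcdT hpsiT; have kerTadj := gcd_in_ker gcdTadj hpsiTadj.
have phi_div : divides psiT phi by case: hpsiT => _ _ h _; exact: h.
have psi_div : divides psiTadj psi by case: hpsiTadj => _ _ h _; exact: h.
(* T^* kills psiT H^2, so the range of T is orthogonal to it *)
have ranT f : orthocomp (mult_range psiT) (T f).
  by move=> g /kerT gker; rewrite adjT gker h2dot0r.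
apply/funext => f; rewrite /= /model_projection /model_space.
set p := orthproj (orthocomp (mult_range psiTadj)) f.
(* f - p is orthogonal to Q_psiTadj, which contains the range of T^* *)
have Tp : T f = T p.
  apply/eqP; rewrite -subr_eq0 -linearB; apply/eqP/h2dot_ff_eq0.
  rewrite adjT; apply: (orthprojP (mult_range psiTadj) f).2 => m /kerTadj mker.
  by apply: h2dot_eq0_sym; rewrite -adjT mker h2dot0l.
have psi_p : orthproj (orthocomp (mult_range psi)) p = p.
  apply: orthproj_id => m mpsi; apply: (orthprojP (mult_range psiTadj) f).1.
  exact: mult_range_divides psi_div m mpsi.
rewrite -(orthproj_sub p (mult_range_divides phi_div)).
rewrite -[X in orthproj (orthocomp (mult_range phi)) X]psi_p.
by rewrite -[X in _ = orthproj _ X]/(model_projection phi (model_projection psi p)) -TEf -Tp orthproj_id.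
Qed.
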